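(* Let $S\subset\mathbb{R}^2$ be connected, with empty interior, and proximally $C^1$. Then $S$ is either a singleton, or a $1$-dimensional manifold of class $C^{1,1}$.
   Context: For a nonempty closed set $S\subset\mathbb{R}^n$, $d_S(x):=\min_{y\in S}|x-y|$ denotes the Euclidean distance function from $S$. A set $S\subset\mathbb{R}^n$ is called proximally $C^k$ (of radius $r_S$) if it is nonempty, closed, and there exists $r_S>0$ such that $d_S$ is of class $C^k$ in the set $\{x\in\mathbb{R}^n : 0<d_S(x)<r_S\}$. A function is of class $C^{k,\alpha}$ when all its derivatives up to order $k$ satisfy a Hölder condition of exponent $\alpha$. Here ''$1$-dimensional manifold of class $C^{1,1}$'' means an embedded submanifold of $\mathbb{R}^2$, possibly with boundary. *)

(* Defs.v *)
From HB Require Import structures.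
From mathcomp Require Import all_boot all_order all_algebra.
From mathcomp Require Import all_classical all_reals all_analysis.

Set Implicit Arguments.
Unset Strict Implicit.
Unset Printing Implicit Defensive.

Import Order.TTheory GRing.Theory Num.Theory.
Import numFieldNormedType.Exports.

Local Open Scope classical_set_scope.
Local Open Scope ring_scope.

(* The library norm on 'rV[R]_n is the sup norm: it induces the usual topology
   and the usual derivatives, but not the Euclidean distance. *)
Definition enorm (R : realType) (n : nat) (x : 'rV[R]_n) : R :=
  Num.sqrt (\sum_(i < n) x 0 i ^+ 2).

(* For S nonempty and closed this infimum is attained. *)
Definition dist_to (R : realType) (n : nat) (S : set 'rV[R]_n)
    (x : 'rV[R]_n) : R :=
  inf [set enorm (x - y) | y in S].

(* On the open set U, f has all partial derivatives up to order k, those of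
   order < k are (Frechet) differentiable, and all of them satisfy P. *)
Fixpoint derivs_upto (R : realType) (n : nat) (P : ('rV[R]_n -> R) -> Prop)
    (k : nat) (U : set 'rV[R]_n) (f : 'rV[R]_n -> R) : Prop :=
  P f /\
  if k is j.+1 then
    (forall x, U x -> differentiable f x) /\
    (forall i : 'I_n, derivs_upto P j U (fun x => 'D_(delta_mx 0 i) f x))
  else True.

Definition class_C (R : realType) (n k : nat) (U : set 'rV[R]_n)
    (f : 'rV[R]_n -> R) : Prop :=
  derivs_upto (fun g => forall x, U x -> {for x, continuous g}) k U f.

Definition holder_on (R : realType) (n : nat) (a : R) (U : set 'rV[R]_n)
    (f : 'rV[R]_n -> R) : Prop :=
  exists C : R, forall x y, U x -> U y ->
    `|f x - f y| <= C * enorm (x - y) `^ a.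

Definition class_C_holder (R : realType) (n k : nat) (a : R)
    (U : set 'rV[R]_n) (f : 'rV[R]_n -> R) : Prop :=
  derivs_upto (holder_on a U) k U f.

Definition proximally_C (R : realType) (n k : nat) (S : set 'rV[R]_n) : Prop :=
  [/\ S !=set0, closed S &
      exists2 r : R, 0 < r &
        class_C k [set x | 0 < dist_to S x < r] (dist_to S)].

(* Only the values of phi on U and of psi on V matter. *)
Definition diffeo_C_holder (R : realType) (n k : nat) (a : R)
    (U V : set 'rV[R]_n) (phi psi : 'rV[R]_n -> 'rV[R]_n) : Prop :=
  [/\ (forall x, U x -> V (phi x) /\ psi (phi x) = x),
      (forall y, V y -> U (psi y) /\ phi (psi y) = y),
      (forall i : 'I_n, class_C_holder k a U (fun x => phi x 0 i)) &
      (forall i : 'I_n, class_C_holder k a V (fun y => psi y 0 i))].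

(* R^m x {0} in R^n *)
Definition flat (R : realType) (m n : nat) : set 'rV[R]_n :=
  [set y | forall i : 'I_n, (m <= i)%N -> y 0 i = 0].

(* H^m x {0} in R^n, where H^m is the half-space {y_m >= 0} of R^m; the m-th
   coordinate has index m - 1. *)
Definition half_flat (R : realType) (m n : nat) : set 'rV[R]_n :=
  [set y | @flat R m n y /\ forall i : 'I_n, i.+1 = m -> 0 <= y 0 i].

(* Embedded m-dimensional submanifold of R^n, possibly with boundary, of class
   C^{k,a}, defined by ambient slice charts.  As the chart domains may be
   shrunk, the Hoelder condition is local. *)
Definition submanifold_C_holder (R : realType) (n k : nat) (a : R) (m : nat)
    (S : set 'rV[R]_n) : Prop :=
  forall p, S p ->
  exists (U V : set 'rV[R]_n) (phi psi : 'rV[R]_n -> 'rV[R]_n),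
    [/\ open U /\ U p, open V, diffeo_C_holder k a U V phi psi &
        phi @` (S `&` U) = V `&` @flat R m n \/
        phi @` (S `&` U) = V `&` @half_flat R m n].

(* Main.v *)
Require Import Defs.
From mathcomp Require Import all_boot all_order all_algebra.
From mathcomp Require Import all_classical all_reals all_analysis.
From mathcomp Require Import ring lra.

Import Order.TTheory GRing.Theory Num.Theory.
Import numFieldNormedType.Exports.

Local Open Scope classical_set_scope.
Local Open Scope ring_scope.

(* Wherever the distance d to S is differentiable and positive, its gradient is
   the unit vector pointing away from the nearest point.  Hence d cannot stop
   increasing along a normal ray before the radius r, so every point outside S
   near S is p + d u, where p is in S and the open ball of radius r / 2 and
   center p + (r / 2) u misses S, that is <s - p, u> <= |s - p|^2 / r for all
   s in S.

   In the plane this gives everything.  The midpoint of two points of S at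
   distance D is within D^2 / r of S.  Near such a point the normals are almost
   orthogonal to the chord, and both signs occur because S has empty interior;
   letting the chord shrink to y gives, for every y in S, a unit vector n with
   |<s - y, n>| <= |s - y|^2 / r on S.  These normals vary little near y, so S is
   locally a graph over a set of abscissae, with a quadratic Taylor remainder,
   hence of class C^{1,1}.  By the midpoint property that set is an interval;
   the graph is either a curve through y or a ray starting at y. *)

Set Implicit Arguments.
Unset Strict Implicit.
Unset Printing Implicit Defensive.

(** * Euclidean norm and distance to a closed set *)

Section EuclideanNorm.
Variables (R : realType) (n : nat).
Implicit Types (x y z : 'rV[R]_n) (t : R).

Definition dot x y : R := \sum_(i < n) x 0 i * y 0 i.

Lemma dotC x y : dot x y = dot y x.
Proof. by apply: eq_bigr => i _; rewrite mulrC. Qed.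

Lemma dotDl x y z : dot (x + y) z = dot x z + dot y z.
Proof. by rewrite -big_split; apply: eq_bigr => i _; rewrite mxE mulrDl. Qed.

Lemma dotZl t x y : dot (t *: x) y = t * dot x y.
Proof. by rewrite mulr_sumr; apply: eq_bigr => i _; rewrite mxE mulrA. Qed.

Lemma dotNl x y : dot (- x) y = - dot x y.
Proof. by rewrite -scaleN1r dotZl mulN1r. Qed.

Lemma dotDr x y z : dot x (y + z) = dot x y + dot x z.
Proof. by rewrite dotC dotDl !(dotC x). Qed.

Lemma dotZr t x y : dot x (t *: y) = t * dot x y.
Proof. by rewrite dotC dotZl (dotC x). Qed.

Lemma dotNr x y : dot x (- y) = - dot x y.
Proof. by rewrite dotC dotNl (dotC x). Qed.

Definition dotE := (dotDl, dotDr, dotNl, dotNr, dotZl, dotZr).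

Lemma dot_ge0 x : 0 <= dot x x.
Proof. by apply: sumr_ge0 => i _; rewrite -expr2 sqr_ge0. Qed.

Lemma dot_eq0 x : dot x x = 0 -> x = 0.
Proof.
move=> /eqP; rewrite psumr_eq0; last by move=> i _; rewrite -expr2 sqr_ge0.
move=> /allP xx0; apply/rowP => i; rewrite mxE; apply/eqP.
by have /= := xx0 i (mem_index_enum i); rewrite -expr2 sqrf_eq0.
Qed.

Lemma enorm_ge0 x : 0 <= enorm x.
Proof. exact: sqrtr_ge0. Qed.

Lemma sqr_enorm x : enorm x ^+ 2 = dot x x.
Proof.
rewrite sqr_sqrtr; last by apply: sumr_ge0 => i _; rewrite sqr_ge0.
by apply: eq_bigr => i _; rewrite expr2.
Qed.

Lemma enorm_eq0 x : enorm x = 0 -> x = 0.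
Proof. by move=> x0; apply: dot_eq0; rewrite -sqr_enorm x0 expr0n. Qed.

Lemma enormP x t : 0 <= t -> dot x x = t ^+ 2 -> enorm x = t.
Proof.
by move=> t0 xt; apply/eqP; rewrite -(@eqrXn2 _ 2) ?enorm_ge0// sqr_enorm xt.
Qed.

Lemma enorm0 : enorm (0 : 'rV[R]_n) = 0.
Proof. by apply: enormP => //; rewrite -(scale0r 0) !dotE mul0r expr0n. Qed.

Lemma enormZ t x : enorm (t *: x) = `|t| * enorm x.
Proof.
apply: enormP; first by rewrite mulr_ge0// enorm_ge0.
by rewrite !dotE exprMn sqr_enorm real_normK ?num_real// expr2 mulrA.
Qed.

Lemma enormN x : enorm (- x) = enorm x.
Proof. by rewrite -scaleN1r enormZ normrN1 mul1r. Qed.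

Lemma enormB x y : enorm (x - y) = enorm (y - x).
Proof. by rewrite -enormN opprB. Qed.

(** Cauchy-Schwarz, by expanding the squared norm of [enorm y *: x - enorm x *: y]. *)
Lemma dot_le_enorm x y : dot x y <= enorm x * enorm y.
Proof.
have [x0|x0] := eqVneq (enorm x) 0.
  by rewrite x0 mul0r (enorm_eq0 x0) -(scale0r 0) dotZl mul0r.
have [y0|y0] := eqVneq (enorm y) 0.
  by rewrite y0 mulr0 (enorm_eq0 y0) -(scale0r 0) dotZr mul0r.
have xy : 0 < enorm x * enorm y by rewrite mulr_gt0// lt0r enorm_ge0 ?x0 ?y0.
have := dot_ge0 (enorm y *: x - enorm x *: y).
rewrite !dotE (dotC y x) -!sqr_enorm => h.
rewrite -(ler_pM2l xy); nra.
Qed.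

Lemma ler_enormD x y : enorm (x + y) <= enorm x + enorm y.
Proof.
rewrite -(@ler_pXn2r _ 2) ?nnegrE ?addr_ge0 ?enorm_ge0//.
rewrite sqr_enorm !dotE (dotC y x) sqrrD !sqr_enorm.
by have := dot_le_enorm x y; lra.
Qed.
Lemma normr_coord_enorm x i : `|x 0 i| <= enorm x.
Proof.
rewrite -(@ler_pXn2r _ 2) ?nnegrE ?enorm_ge0// real_normK ?num_real//.
rewrite sqr_enorm /dot (bigD1 i)//= -expr2 lerDl sumr_ge0// => j _.
by rewrite -expr2 sqr_ge0.
Qed.

Lemma normr_enorm x : `|x| <= enorm x.
Proof.
rewrite /Num.norm/= mx_normrE; apply/bigmax_leP; split; first exact: enorm_ge0.
by move=> [i j] _ /=; rewrite (ord1 i) normr_coord_enorm.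
Qed.

Lemma continuous_enorm : continuous (@enorm R n).
Proof.
have cs x : \sum_(i < n) z 0 i ^+ 2 @[z --> x] --> \sum_(i < n) x 0 i ^+ 2.
  apply: cvg_big => [|i _]; first exact: add_continuous.
  rewrite expr2; under eq_fun do rewrite expr2.
  by apply: cvgM; exact: coord_continuous.
by move=> x; exact: continuous_cvg _ (@sqrt_continuous R _) (cs x).
Qed.

Lemma continuous_enormB x : continuous (fun z : 'rV[R]_n => enorm (z - x)).
Proof.
have cB z : y - x @[y --> z] --> z - x.
  exact: (cvgB cvg_id (cvg_cst _)).
by move=> z; exact: continuous_cvg _ (@continuous_enorm (z - x)) (cB z).
Qed.

Lemma compact_enorm_ball x t : compact [set z | enorm (z - x) <= t].
Proof.
apply: bounded_closed_compact.
  exists (t + `|x|); split; first exact: num_real.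
  move=> b tb z /= zt; rewrite (le_trans _ (ltW tb))// -{1}(subrK x z).
  by rewrite (le_trans (ler_normD _ _))// lerD2r (le_trans (normr_enorm _)).
have -> : [set z | enorm (z - x) <= t] = (fun z => enorm (z - x)) @^-1` [set r | r <= t] by [].
apply: closed_comp; last exact: closed_le.
by move=> z _; exact: continuous_enormB.
Qed.
End EuclideanNorm.

Section Distance.
Variables (R : realType) (n : nat) (S : set 'rV[R]_n).
Hypothesis S0 : S !=set0.
Implicit Types (x y z p : 'rV[R]_n) (t : R).
Local Notation d := (dist_to S).

Let has_inf_dist x : has_inf [set enorm (x - y) | y in S].
Proof.
split; first by case: S0 => y Sy; exists (enorm (x - y)), y.
by exists 0 => _ [y _ <-]; exact: enorm_ge0.
Qed.

Lemma dist_to_le x y : S y -> d x <= enorm (x - y).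
Proof. by move=> Sy; apply: ge_inf; [case: (has_inf_dist x)|exists y]. Qed.

Lemma dist_to_ge x t : (forall y, S y -> t <= enorm (x - y)) -> t <= d x.
Proof.
move=> tS; apply: lb_le_inf; first by case: (has_inf_dist x).
by move=> _ [y Sy <-]; exact: tS.
Qed.

Lemma dist_to_ge0 x : 0 <= d x.
Proof. by apply: dist_to_ge => y _; exact: enorm_ge0. Qed.

Lemma dist_to_lip x z : d x <= d z + enorm (x - z).
Proof.
rewrite -lerBlDr; apply: dist_to_ge => y Sy; rewrite lerBlDr.
rewrite (le_trans (dist_to_le x Sy))//.
have -> : x - y = (z - y) + (x - z) by rewrite [RHS]addrC subrKA.
exact: ler_enormD.
Qed.

Lemma continuous_dist_to : continuous d.
Proof.
suff cs x (e : R) : 0 < e -> \forall z \near x, `|d x - d z| < e.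
  by move=> x; apply/(cvgrPdist_lt (FF := nbhs_filter x)) => e e0; exact: cs.
move=> e0; have /cvgr0_norm_lt/(_ e e0) : enorm (x - z) @[z --> x] --> (0 : R).
  rewrite -(enorm0 R n) -(subrr x); under eq_fun do rewrite enormB.
  exact: continuous_enormB.
apply: filterS => z; rewrite ger0_norm ?enorm_ge0// => xz.
rewrite (le_lt_trans _ xz)// ler_norml.
have := dist_to_lip x z; have := dist_to_lip z x; rewrite (enormB z); lra.
Qed.

Hypothesis cS : closed S.

(** The minimum is taken over the compact part of [S] in a closed ball around [x] that reaches some
    point of [S]; all other points of [S] are farther away. *)
Lemma dist_to_attained x : exists2 p, S p & d x = enorm (x - p).
Proof.
have [y Sy] := S0.
have cK : compact (S `&` [set z | enorm (z - x) <= enorm (y - x)]).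
  by rewrite setIC; apply: compact_closedI => //; exact: compact_enorm_ball.
have [||p] := @compact_EVT_min _ _ (fun z => enorm (z - x)) _ _ cK.
- by exists y; split => //=.
- by apply: continuous_subspaceT; exact: continuous_enormB.
rewrite inE => -[Sp px] pmin; exists p => //; apply/le_anti/andP; split.
  exact: dist_to_le.
rewrite enormB.
apply: dist_to_ge => z Sz.
have [zx|zx] := leP (enorm (z - x)) (enorm (y - x)).
  by rewrite [leRHS]enormB; apply: pmin; rewrite inE.
by rewrite [leRHS]enormB (le_trans px)// ltW.
Qed.

Lemma dist_to_gt0 x : ~ S x -> 0 < d x.
Proof.
move=> Sx; rewrite lt0r dist_to_ge0 andbT; apply/eqP.
have [p Sp ->] := dist_to_attained x => /enorm_eq0 /eqP; rewrite subr_eq0 => /eqP xp.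
by apply: Sx; rewrite xp.
Qed.

End Distance.

(** * Proximal normals *)

Section Gradient.
Variables (R : realType) (n : nat) (S : set 'rV[R]_n).
Hypotheses (S0 : S !=set0) (cS : closed S).
Implicit Types (x y z p u v : 'rV[R]_n) (t h : R).
Local Notation d := (dist_to S).

(** Moving from [x] straight towards [p] lowers the distance at unit rate: [p] gives one inequality,
    the Lipschitz property the other. So the left difference quotient is 1, and differentiability
    makes this the derivative. *)
Lemma derive_dist_to x p : S p -> d x = enorm (x - p) -> 0 < d x ->
  differentiable d x -> 'D_((d x)^-1 *: (x - p)) d x = 1.
Proof.
move=> Sp dxp dx0 dd; set v := _ *: _.
have ev : enorm v = 1.
  by rewrite /v enormZ -dxp ger0_norm ?invr_ge0 ?ltW// mulVf// gt_eqF.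
have dl h : h < 0 -> - d x < h -> d (h *: v + x) = d x + h.
  move=> h0 dh; apply/le_anti/andP; split.
    rewrite (le_trans (dist_to_le S0 _ Sp))//.
    have -> : h *: v + x - p = (1 + h / d x) *: (x - p).
      by rewrite -addrA addrC scalerDl scale1r /v scalerA.
    rewrite enormZ -dxp ger0_norm.
      by rewrite mulrDl mul1r divfK// gt_eqF.
    by rewrite -(pmulr_rge0 _ dx0) mulrDr mulr1 mulrCA mulfV ?gt_eqF//; lra.
  rewrite -lerBrDr (le_trans (dist_to_lip S0 x (h *: v + x)))//.
  by rewrite opprD addrCA subrr addr0 enormN enormZ ev mulr1 ltr0_norm.
have /cvg_dnbhs_at_left dL : h^-1 *: ((d \o shift x) (h *: v) - d x) @[h --> 0^'] --> 'D_v d x.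
  exact: diff_derivable.
apply/esym; apply: (cvg_unique _ _ dL) => //.
apply: cvg_near_cst; near=> h.
have h0 : h < 0 by [].
rewrite /= dl//; last by near: h; apply: nbhs_left_gt; rewrite oppr_lt0.
by rewrite addrC addKr /GRing.scale/= mulVf// lt_eqF.
Unshelve. all: by end_near. Qed.

Variable r : R.
Hypothesis dd : forall x, 0 < d x < r -> differentiable d x.

(* At a maximum of d - k |. - x| on the ball, k < 1, moving along the unit
   gradient of d increases this function, so the maximum is on the sphere. *)
Lemma dist_to_ascent x (e : R) : 0 < d x -> 0 < e -> d x + e < r ->
  exists2 z, enorm (z - x) <= e & d x + e <= d z.
Proof.
move=> dx0 e0 dxer.
have ballx : [set z | enorm (z - x) <= e] !=set0.
  by exists x; rewrite /= subrr enorm0 ltW.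
have cball := @compact_enorm_ball _ _ x e.
have [|z] := compact_EVT_max ballx cball (f := d).
  by apply: continuous_subspaceT; exact: (continuous_dist_to S0).
rewrite inE /= => zx zmax; exists z => //; apply/ler_addgt0Pl => eta eta0.
wlog eta1 : eta eta0 / eta < e.
  move=> /(_ (Num.min eta (e / 2))); rewrite lt_min eta0 divr_gt0// gt_min orbC.
  rewrite ltr_pdivrMr// ltr_pMr// ltrDl ltr01 => /(_ isT isT) h.
  by rewrite (le_trans h)// lerD2r ge_min lexx.
(* If the maximum [y] of [f] lies on the sphere, then [d x <= d y - k * e = d y - e + eta], which is
   the goal since [d y <= d z]. The condition [eta < e] keeps [k] positive. *)
pose k := 1 - eta / e.
have k0 : 0 < k by rewrite subr_gt0 ltr_pdivrMr// mul1r.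
have k1 : k < 1 by rewrite ltrBlDr ltrDl divr_gt0.
pose f y := d y - k * enorm (y - x).
have [|y] := compact_EVT_max ballx cball (f := f).
  apply: continuous_subspaceT => y.
  exact: (cvgB (@continuous_dist_to _ _ _ S0 y) (cvgM (cvg_cst k) (@continuous_enormB _ _ x y))).
rewrite inE /= => yx ymax.
have fy : d x <= f y.
  have := ymax x; rewrite inE /= /f subrr enorm0 mulr0 subr0; apply.
  exact: ltW.
have dy : 0 < d y by rewrite (lt_le_trans dx0)// (le_trans fy)// /f gerBl mulr_ge0 ?enorm_ge0 ?ltW.
suff yxe : enorm (y - x) = e.
  have dyz : d y <= d z by apply: zmax; rewrite inE.
  by move: fy; rewrite /f yxe /k mulrBl mul1r divfK ?gt_eqF// => fy; lra.
apply/le_anti/andP; split => //; rewrite leNgt; apply/negP => yxe.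
have dyr : d y < r.
  by rewrite (le_lt_trans _ dxer)// (le_trans (dist_to_lip S0 y x))// lerD2l.
have [p Sp dyp] := dist_to_attained S0 cS y.
have ddy : differentiable d y by apply: dd; rewrite dy.
have := derive_dist_to Sp dyp dy ddy; set v := _ *: _ => Dv.
have ev : enorm v = 1.
  by rewrite /v enormZ -dyp ger0_norm ?invr_ge0 ?ltW// mulVf// gt_eqF.
have : h^-1 *: ((d \o shift y) (h *: v) - d y) @[h --> 0^'] --> 'D_v d y.
  exact: diff_derivable.
rewrite Dv => /cvg_dnbhs_at_right /cvgr_gt/(_ _ k1) dh.
(* For such an [h], the move along [v] raises [d] by more than [k * h] and [k * enorm (. - x)] by at
   most [k * h], against the maximality at [y]. *)
suff [h [h0 hyx kh]] : exists h, [/\ 0 < h, h <= e - enorm (y - x) &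
    k < h^-1 *: (d (h *: v + y) - d y)].
  have := ymax (h *: v + y); rewrite inE /= /f.
  have hx : enorm (h *: v + y - x) <= h + enorm (y - x).
    by rewrite -addrA (le_trans (ler_enormD _ _))// enormZ ev mulr1 ger0_norm// ltW.
  have -> : enorm (h *: v + y - x) <= e by rewrite (le_trans hx)// -lerBrDr.
  move=> /(_ isT); apply/negP; rewrite -ltNge.
  move: kh; rewrite /GRing.scale/= mulrC ltr_pdivlMr// => kh.
  have := ler_wpM2l (ltW k0) hx; rewrite mulrDr; lra.
near (0 : R)^'+ => h; exists h; split.
- by [].
- by near: h; apply: nbhs_right_le; rewrite subr_gt0.
- by near: h.
Unshelve. all: by end_near. Qed.
(** Climbing from [x] by [r / 2 - d x] reaches a point [z] with [r / 2 <= d z]. As [z] is at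
    distance at most [r / 2] from [p], the triangle inequality through [x] is an equality and
    [z = p + (r / 2) u]. The last claim is the expansion of [(r / 2)^2 <= |z - s|^2]. *)
Lemma proximal_normal x : ~ S x -> d x < r / 2 ->
  exists p u, [/\ S p, dot u u = 1, x = p + d x *: u &
    forall s, S s -> r * dot (s - p) u <= dot (s - p) (s - p)].
Proof.
move=> Sx dxr; have dx0 := dist_to_gt0 S0 cS Sx.
have [p Sp dxp] := dist_to_attained S0 cS x.
have [u xp uu] : exists2 u, x - p = d x *: u & dot u u = 1.
  exists ((d x)^-1 *: (x - p)); first by rewrite scalerA mulfV ?scale1r// gt_eqF.
  by rewrite dotZl dotZr -sqr_enorm -dxp; field; rewrite gt_eqF.
exists p, u; split => //; first by rewrite -xp addrC subrK.
have [||z] := dist_to_ascent (e := r / 2 - d x) dx0; [lra|lra|].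
rewrite (addrC (d x)) subrK; set e := r / 2 - d x => zx dz.
have e0 : 0 < e by rewrite subr_gt0.
have ww : dot (z - x) (z - x) <= e ^+ 2.
  by rewrite -sqr_enorm ler_pXn2r// ?nnegrE ?enorm_ge0// ltW.
have far s : S s -> (r / 2) ^+ 2 <= dot (z - s) (z - s).
  move=> Ss; rewrite -sqr_enorm ler_pXn2r ?nnegrE ?enorm_ge0//; last by lra.
  by rewrite (le_trans dz)// dist_to_le.
have zp : z - p = (z - x) + d x *: u by rewrite -xp addrA subrK.
have zxu : z - x = e *: u.
  apply/eqP; rewrite -subr_eq0; apply/eqP/dot_eq0/le_anti; rewrite dot_ge0 andbT.
  have := far _ Sp; rewrite zp; move: (z - x) ww => w ww.
  rewrite !dotE uu (dotC u w) => fw.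
  have we : e <= dot w u.
    rewrite -(ler_pM2l dx0); rewrite /e in ww *; nra.
  nra.
move=> s Ss; have := far _ Ss.
have -> : z - s = (r / 2) *: u - (s - p).
  by rewrite opprB addrA -(subrK p z) zp zxu -scalerDl subrK.
move: (s - p) => w; rewrite !dotE uu (dotC u) => h; lra.
Qed.

End Gradient.

(** * Plane sets with proximal normals *)

Section PlaneSets.
Variable R : realType.
Implicit Types (P : R -> R -> Prop) (K rho : R).

(* From here on, points of the plane are pairs of coordinates and a plane set is
   a relation between coordinates; dsq is the squared Euclidean distance. *)
Definition dsq (a b a' b' : R) : R := (a' - a) ^+ 2 + (b' - b) ^+ 2.

Lemma dsqC a b a' b' : dsq a b a' b' = dsq a' b' a b.
Proof. by rewrite /dsq; ring. Qed.

(** For a unit vector [(u, v)] and [0 < K], the open disc of radius [1 / (2 K)] tangent at [(p, q)]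
    on the side of [(u, v)] misses [P]. *)
Definition supports P K p q u v :=
  forall s t, P s t -> (s - p) * u + (t - q) * v <= K * dsq p q s t.

(* P is closed, has empty interior and no isolated point, and every point
   outside P at squared distance less than rho from P has a nearest point in P
   at which P is supported by a ball. *)
Definition proximal_curve P K rho :=
  [/\ (forall a b, ~ P a b ->
         exists2 e, 0 < e & forall s t, dsq a b s t < e -> ~ P s t),
      (forall a b e, 0 < e -> exists s t, ~ P s t /\ dsq a b s t < e),
      (forall a b e, P a b -> 0 < e ->
         exists s t, P s t /\ 0 < dsq a b s t < e) &
      (forall a b s t, ~ P a b -> P s t -> dsq a b s t < rho ->
         exists p q u v h, [/\ [/\ P p q, u ^+ 2 + v ^+ 2 = 1 & 0 < h],
           a = p + h * u, b = q + h * v,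
           (forall s t, P s t -> h ^+ 2 <= dsq a b s t) &
           supports P K p q u v])].

Section Frame.
Variables (e1 e2 k : R).
Hypotheses (ee : e1 ^+ 2 + e2 ^+ 2 = 1) (kk : k ^+ 2 = 1).

(* P in the orthonormal frame with origin (y1, y2), first axis (e1, e2), and
   second axis (e1, e2) rotated by a right angle, the sign k being the
   orientation. *)
Definition frame (y1 y2 : R) P a b :=
  P (y1 + (a * e1 - k * b * e2)) (y2 + (a * e2 + k * b * e1)).

Lemma dsq_frame y1 y2 a b a' b' :
  dsq (y1 + (a * e1 - k * b * e2)) (y2 + (a * e2 + k * b * e1))
      (y1 + (a' * e1 - k * b' * e2)) (y2 + (a' * e2 + k * b' * e1)) =
  dsq a b a' b'.
Proof.
(* The identities of this section hold modulo [ee] and [kk]: the intermediate term displays the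
   factors [e1 ^+ 2 + e2 ^+ 2] and [k ^+ 2], leaving polynomial identities to [ring]. *)
transitivity (((a' - a) ^+ 2 + k ^+ 2 * (b' - b) ^+ 2) * (e1 ^+ 2 + e2 ^+ 2)).
  by rewrite /dsq; ring.
by rewrite ee kk mulr1 mul1r.
Qed.

Lemma frame_point y1 y2 x1 x2 : exists a b,
  x1 = y1 + (a * e1 - k * b * e2) /\ x2 = y2 + (a * e2 + k * b * e1).
Proof.
exists ((x1 - y1) * e1 + (x2 - y2) * e2), (k * ((x2 - y2) * e1 - (x1 - y1) * e2)).
split.
  transitivity (y1 + ((x1 - y1) * (e1 ^+ 2 + k ^+ 2 * e2 ^+ 2) +
    (1 - k ^+ 2) * ((x2 - y2) * e2 * e1))).
    by rewrite kk mul1r ee; ring.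
  by ring.
transitivity (y2 + ((x2 - y2) * (k ^+ 2 * e1 ^+ 2 + e2 ^+ 2) +
    (1 - k ^+ 2) * ((x1 - y1) * e2 * e1))).
  by rewrite kk mul1r ee; ring.
by ring.
Qed.

Lemma frame_vector u v : u ^+ 2 + v ^+ 2 = 1 -> exists a b,
  [/\ a ^+ 2 + b ^+ 2 = 1, u = a * e1 - k * b * e2 & v = a * e2 + k * b * e1].
Proof.
have [a [b [ua vb]]] := frame_point 0 0 u v; rewrite !add0r in ua vb => uv.
exists a, b; split => //; rewrite -uv ua vb.
transitivity ((a ^+ 2 + k ^+ 2 * b ^+ 2) * (e1 ^+ 2 + e2 ^+ 2)); last by ring.
by rewrite ee kk mulr1 mul1r.
Qed.

Lemma supports_frame P K y1 y2 p q u v :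
  supports P K (y1 + (p * e1 - k * q * e2)) (y2 + (p * e2 + k * q * e1))
    (u * e1 - k * v * e2) (u * e2 + k * v * e1) <->
  supports (frame y1 y2 P) K p q u v.
Proof.
split => [PK s t Pst|PK x1 x2].
  have := PK _ _ Pst; rewrite dsq_frame; congr (_ <= _).
  transitivity (((s - p) * u + k ^+ 2 * (t - q) * v) * (e1 ^+ 2 + e2 ^+ 2)).
    by ring.
  by rewrite ee kk mulr1 mul1r.
have [a [b [-> ->]]] := frame_point y1 y2 x1 x2 => /PK.
rewrite dsq_frame; congr (_ <= _).
transitivity (((a - p) * u + k ^+ 2 * (b - q) * v) * (e1 ^+ 2 + e2 ^+ 2)).
  by rewrite ee kk mulr1 mul1r.
by ring.
Qed.

Lemma proximal_curve_frame P K rho y1 y2 :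
  proximal_curve P K rho -> proximal_curve (frame y1 y2 P) K rho.
Proof.
case=> Pclosed Pthin Paccu Pnormal; split.
- move=> a b /Pclosed[e e0 Pe]; exists e => // s t; rewrite -(dsq_frame y1 y2).
  exact: Pe.
- move=> a b e /(Pthin (y1 + (a * e1 - k * b * e2)) (y2 + (a * e2 + k * b * e1))).
  move=> [x1 [x2 []]]; have [s [t [-> ->]]] := frame_point y1 y2 x1 x2.
  by rewrite dsq_frame => ? ?; exists s, t.
- move=> a b e Pab /(Paccu _ _ _ Pab).
  move=> [x1 [x2 []]]; have [s [t [-> ->]]] := frame_point y1 y2 x1 x2.
  by rewrite dsq_frame => ? ?; exists s, t.
- move=> a b s t Pab Pst; rewrite -(dsq_frame y1 y2) => /(Pnormal _ _ _ _ Pab Pst).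
  move=> [p [q [u [v [h []]]]]].
  have [p' [q' [-> ->]]] := frame_point y1 y2 p q.
  case=> Ppq /frame_vector[u' [v' [uv' -> ->]]] h0 ea eb hP /supports_frame sP.
  exists p', q', u', v', h.
  (* The frame map preserves [dsq], so it is injective: equality of the two points is read off from
     distance zero. *)
  have : dsq (p' + h * u') (q' + h * v') a b = 0.
    by rewrite -(dsq_frame y1 y2) ea eb /dsq; ring.
  move=> /eqP; rewrite paddr_eq0 ?sqr_ge0// !sqrf_eq0 !subr_eq0.
  move=> /andP[/eqP ap /eqP bq]; split => // s' t' Pst'.
  by rewrite -(dsq_frame y1 y2); exact: hP.
Qed.

End Frame.

Section Midpoint.
Variables (P : R -> R -> Prop) (K rho : R).
Hypotheses (K0 : 0 < K) (PC : proximal_curve P K rho).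

(** If the midpoint is outside [P], let [h] be its distance to the nearest point and [D] the squared
    chord. Adding the support inequalities at both endpoints and using the parallelogram law gives
    [2 h <= K (2 h^2 + D / 2)]; since [h^2 <= D / 4], this is at most [K D]. *)
Lemma midpoint_near a b s t : P a b -> P s t -> dsq a b s t < rho ->
  exists p q, P p q /\ dsq ((a + s) / 2) ((b + t) / 2) p q <= (K * dsq a b s t) ^+ 2.
Proof.
move=> Pab Pst abst.
have [Pm|Pm] := pselect (P ((a + s) / 2) ((b + t) / 2)).
  exists ((a + s) / 2), ((b + t) / 2); split => //.
  by rewrite {1}/dsq !subrr expr0n addr0 sqr_ge0.
have D0 : 0 <= dsq a b s t by rewrite addr_ge0 ?sqr_ge0.
have mab : dsq ((a + s) / 2) ((b + t) / 2) a b = dsq a b s t / 4.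
  by rewrite /dsq; field.
have [_ _ _ Pnormal] := PC.
have [|p [q [u [v [h [[Ppq uv h0] mp mq hP sP]]]]]] := Pnormal _ _ _ _ Pm Pab.
  by rewrite mab; lra.
exists p, q; split => //.
have -> : dsq ((a + s) / 2) ((b + t) / 2) p q = h ^+ 2.
  by rewrite mp mq /dsq -[RHS]mulr1 -uv; ring.
have hab := hP _ _ Pab; rewrite mab in hab.
have sab := sP _ _ Pab; have sst := sP _ _ Pst.
have par : dsq p q a b + dsq p q s t = 2 * h ^+ 2 + dsq a b s t / 2.
  transitivity (2 * (((a + s) / 2 - p) ^+ 2 + ((b + t) / 2 - q) ^+ 2) + dsq a b s t / 2).
    by rewrite /dsq; field.
  by rewrite mp mq -[h ^+ 2]mulr1 -uv; ring.
have hh : 2 * h = (a - p) * u + (b - q) * v + ((s - p) * u + (t - q) * v).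
  transitivity (2 * (((a + s) / 2 - p) * u + ((b + t) / 2 - q) * v)); last by field.
  by rewrite mp mq -[h in LHS]mulr1 -uv; ring.
have hK : h <= K * dsq a b s t.
  have : 2 * h <= K * (dsq p q a b + dsq p q s t) by rewrite hh mulrDr lerD.
  rewrite par => h2.
  have : K * (2 * h ^+ 2 + dsq a b s t / 2) <= K * dsq a b s t.
    by rewrite ler_pM2l//; lra.
  by lra.
by rewrite ler_pXn2r ?nnegrE ?mulr_ge0 ?(ltW h0) ?(ltW K0).
Qed.

End Midpoint.
End PlaneSets.

(** * Supporting directions near a chord *)

Section ChordNormals.
Variable R : realType.

Lemma sqr_bound (x y m : R) : 0 <= m -> x ^+ 2 + y ^+ 2 <= m ^+ 2 ->
  - m <= x <= m /\ - m <= y <= m.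
Proof.
suff half a b : 0 <= m -> a ^+ 2 + b ^+ 2 <= m ^+ 2 -> - m <= a <= m.
  by move=> m0 xym; split; [exact: half xym|apply: (@half y x) => //; rewrite addrC].
move=> m0 abm; rewrite -ler_norml -(@ler_pXn2r _ 2) ?nnegrE ?normr_ge0//.
by rewrite real_normK ?num_real//; have := sqr_ge0 b; lra.
Qed.

Lemma sqr_le_of_bound (x m : R) : - m <= x <= m -> x ^+ 2 <= m ^+ 2.
Proof.
rewrite -ler_norml => xm; rewrite -real_normK ?num_real//.
by rewrite ler_pXn2r ?nnegrE ?normr_ge0// (le_trans _ xm).
Qed.

Lemma mul_bound (x y m c : R) : - m <= x <= m -> - c <= y <= c ->
  - (m * c) <= x * y <= m * c.
Proof. by rewrite -!ler_norml normrM => *; rewrite ler_pM. Qed.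

Lemma unit_bound (u v : R) : u ^+ 2 + v ^+ 2 = 1 -> - 1 <= u <= 1 /\ - 1 <= v <= 1.
Proof. by move=> uv; apply: sqr_bound; rewrite ?expr1n ?uv. Qed.

(** The constants are those met in [chord_normal]; 6 suffices because [6 * (12 / 25)] exceeds
    [51 / 20]. *)
Lemma bound_of_mul (a u k s : R) : 0 < s -> 0 < k -> 12 / 25 * s <= a ->
  a * u <= 51 / 20 * (k * s) -> u <= 6 * k.
Proof.
move=> s0 k0 sa au; rewrite leNgt; apply/negP => uk.
have ks : 0 < k * s by rewrite mulr_gt0.
have : 12 / 25 * s * (6 * k) <= a * u by rewrite ler_pM// ?mulr_ge0 ?ltW.
lra.
Qed.

(* The nearest point p to a point just above the midpoint of the chord
   from 0 to (s, 0): P is supported at p in an almost vertical direction (u, v),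
   which points up because the point of P near the midpoint lies below. *)
Lemma chord_normal (P : R -> R -> Prop) (K rho s : R) : 0 < K ->
  proximal_curve P K rho -> P 0 0 -> P s 0 -> 0 < s -> s ^+ 2 < rho ->
  K * s <= 1 / 100 ->
  exists p q u v, [/\ supports P K p q u v, u ^+ 2 + v ^+ 2 = 1,
    - s <= p <= s /\ - s <= q <= s, - (6 * (K * s)) <= u <= 6 * (K * s) & 0 < v].
Proof.
move=> K0 PC P0 Ps s0 srho Ks.
have [_ Pthin _ Pnormal] := PC.
have Ds : dsq 0 0 s 0 = s ^+ 2 by rewrite /dsq; ring.
have [|w1 [w2 [Pw]]] := midpoint_near K0 PC P0 Ps; first by rewrite Ds.
rewrite Ds !add0r mul0r [K * _]mulrA; set k := K * s in Ks *.
have k0 : 0 < k by rewrite mulr_gt0.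
set m := k * s; have m0 : 0 < m by rewrite mulr_gt0.
have ms : m <= s / 100 by rewrite /m; nra.
move=> /sqr_bound -/(_ (ltW m0))[w1b w2b].
(* [m = K s^2] bounds the distance from the midpoint to [(w1, w2)]. A point outside [P] is taken
   within [t / 100] of [(w1, w2 + t)], so that its nearest point stays within a multiple of [m] of
   the midpoint. *)
pose t := m / 4.
have t0 : 0 < t by rewrite divr_gt0.
have tt0 : 0 < (t / 100) ^+ 2 by rewrite exprn_gt0// divr_gt0.
have [x1 [x2 [Px /ltW]]] := Pthin w1 (w2 + t) _ tt0.
move=> /sqr_bound -/(_ (ltW (divr_gt0 t0 _)))[//|x1b x2b].
have xw : dsq x1 x2 w1 w2 <= (11 / 10 * t) ^+ 2.
  rewrite /dsq; nra.
have [|p [q [u [v [h [[Ppq uv h0] xp xq hP sP]]]]]] := Pnormal _ _ _ _ Px Pw.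
  rewrite (le_lt_trans xw)// (le_lt_trans _ srho)// ler_pXn2r ?nnegrE//; rewrite /t; lra.
have hw : h <= 11 / 10 * t.
  rewrite -(@ler_pXn2r _ 2) ?nnegrE ?(ltW h0)//; last lra.
  exact: le_trans (hP _ _ Pw) xw.
have [ub vb] := unit_bound uv.
have hu : - h <= h * u <= h by apply/andP; split; nra.
have hv : - h <= h * v <= h by apply/andP; split; nra.
(* Errors add up: [m] from the midpoint to [w], [t / 100] from the choice of [x], [11 / 10 * t] from
   [x] to its nearest point, and for [q] the shift [t]. *)
have pb : - (13 / 10 * m) <= p - s / 2 <= 13 / 10 * m by rewrite /t in x1b hw; lra.
have qb : - (31 / 20 * m) <= q <= 31 / 20 * m by rewrite /t in x2b hw; lra.
have s1 := sP _ _ P0; have s2 := sP _ _ Ps; have s3 := sP _ _ Pw.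
have Km (a b : R) : a ^+ 2 + b ^+ 2 <= s ^+ 2 -> K * (a ^+ 2 + b ^+ 2) <= m.
  by move=> ab; rewrite /m /k -mulrA -expr2 ler_pM2l.
have Kd a : P a 0 -> - (52 / 100 * s) <= a - p <= 52 / 100 * s -> K * dsq p q a 0 <= m.
  move=> _ /sqr_le_of_bound ap; apply: Km.
  have /sqr_le_of_bound qs : - (2 / 100 * s) <= 0 - q <= 2 / 100 * s by lra.
  by rewrite (le_trans (lerD ap qs))//; have := sqr_ge0 s; lra.
have := mul_bound qb vb; rewrite mulr1 => qv.
(* The ends of the chord lie on both sides of [p], at horizontal distance about [s / 2]. The support
   inequalities there bound [u] from both sides, as [q * v] and the quadratic terms are of order
   [m = k * s]. *)
have ubk : - (6 * k) <= u <= 6 * k.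
  have d1 : K * dsq p q 0 0 <= m by apply: Kd => //; lra.
  have d2 : K * dsq p q s 0 <= m by apply: Kd => //; lra.
  have u1 : p * - u <= 51 / 20 * m by clear -s1 d1 qv; lra.
  have u2 : (s - p) * u <= 51 / 20 * m by clear -s2 d2 qv; lra.
  have p1 : 12 / 25 * s <= p by clear -pb ms; lra.
  have p2 : 12 / 25 * s <= s - p by clear -pb ms; lra.
  have := bound_of_mul s0 k0 p1 u1; have := bound_of_mul s0 k0 p2 u2.
  by clear; lra.
exists p, q, u, v; split => //; first by clear -ms pb qb m0; split; lra.
(* Otherwise [(u, v)] is nearly [(0, -1)]. Then [w], which is about [t] below [x], is at least
   [9 / 10 * t] beyond [(p, q)] in that direction, while the support inequality allows only
   [t / 10]. *)
rewrite ltNge; apply/negP => v0.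
have {}v1 : v <= - (99 / 100).
  have /sqr_le_of_bound u2 : - (6 / 100) <= u <= 6 / 100 by clear -ubk Ks; lra.
  rewrite leNgt; apply/negP => v1; clear -u2 v1 v0 uv; nra.
have wu : - (t / 100 * 1) <= (x1 - w1) * u <= t / 100 * 1 by apply: mul_bound.
have wv : - (t / 100 * 1) <= (x2 - w2 - t) * v <= t / 100 * 1.
  by apply: mul_bound => //; clear -x2b; lra.
have tv : t * (99 / 100) <= - (t * v) by rewrite -mulrN ler_pM2l//; clear -v1; lra.
have low : 9 / 10 * t <= (w1 - p) * u + (w2 - q) * v.
  have -> : (w1 - p) * u + (w2 - q) * v = h * (u ^+ 2 + v ^+ 2) -
      (x1 - w1) * u - (x2 - w2 - t) * v - t * v.
    by rewrite xp xq; ring.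
  by rewrite uv; clear -wu wv tv h0 t0; lra.
have up : K * dsq p q w1 w2 <= t / 10.
  have /sqr_le_of_bound a1 : - (3 * t) <= w1 - p <= 3 * t by clear -x1b hu hw xp t0; lra.
  have /sqr_le_of_bound a2 : - (3 * t) <= w2 - q <= 3 * t by clear -x2b hv hw xq t0; lra.
  have Kt : K * t <= 1 / 400.
    have -> : K * t = k * k / 4 by rewrite /t /m /k; field.
    by clear -k0 Ks; nra.
  have : K * dsq p q w1 w2 <= K * (18 * t ^+ 2) by rewrite ler_pM2l// /dsq; clear -a1 a2; lra.
  by clear -Kt t0; nra.
by clear -low up s3 t0; lra.
Qed.

End ChordNormals.

(** * Two-sided normals at the points of the set *)

Section Normals.
Variable R : realType.

Lemma le_of_small (a b c : R) : 0 <= c ->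
  (forall eta, 0 < eta < 1 -> a <= b + eta * c) -> a <= b.
Proof.
move=> c0 abc; apply/ler_addgt0Pr => e e0.
have c1 : 0 < e + c + 1 by clear -e0 c0; lra.
have h : 0 < e / (e + c + 1) < 1.
  by rewrite divr_gt0// ltr_pdivrMr// mul1r; clear -e0 c0; lra.
rewrite (le_trans (abc _ h))// lerD2l mulrAC ler_pdivrMr// ler_pM2l//.
by clear -e0; lra.
Qed.

(** Bolzano-Weierstrass on the square, stated for a cluster point so that no subsequence is
    extracted. *)
Lemma cluster_pair (f : nat -> R * R) :
  (forall i, - 1 <= (f i).1 <= 1 /\ - 1 <= (f i).2 <= 1) ->
  exists c : R * R, forall eta N, 0 < eta -> exists i, [/\ (N <= i)%N,
    `|c.1 - (f i).1| < eta & `|c.2 - (f i).2| < eta].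
Proof.
move=> fb; pose I : set R := `[- 1, 1]%classic.
have cI : compact (I `*` I) by apply: compact_setX; exact: segment_compact.
have [|c [_ cc]] := cI (f @ \oo) _.
  by exists 0%N => //= i _; have [? ?] := fb i; split; rewrite /I/= in_itv.
exists c => eta N eta0.
have [||i [[j Nj <-] []]] := cc (f @` [set i | (N <= i)%N]) (ball c eta).
- by exists N => //= i Ni; exists i.
- exact: nbhsx_ballx.
by exists j.
Qed.

(** Replacing the base point by the origin and the direction by [(0, 1)] costs a multiple of [s] in
    each term: [p] and [q] are at most [s] in size, and [1 - v <= |u|] because
    [u^2 = (1 - v) (1 + v)]. *)
Lemma near_vertical_bound (P : R -> R -> Prop) (K s p q u v a b : R) :
  0 < K -> 0 < s <= 1 -> supports P K p q u v -> u ^+ 2 + v ^+ 2 = 1 ->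
  - s <= p <= s -> - s <= q <= s -> - (6 * (K * s)) <= u <= 6 * (K * s) ->
  0 < v -> P a b ->
  b <= K * (a ^+ 2 + b ^+ 2) + s * (1 + 8 * K * (1 + `|a| + `|b|)).
Proof.
move=> K0 /andP[s0 s1] sP uv ps qs us v0 /sP; rewrite /dsq => h.
rewrite -!ler_norml in ps qs us.
have [ub vb] := unit_bound uv; rewrite -!ler_norml in ub vb.
have vu : 1 - v <= `|u|.
  have u2 : `|u| ^+ 2 = 1 - v ^+ 2 by rewrite real_normK ?num_real// -uv; ring.
  have v1 : v <= 1 by rewrite (le_trans _ vb)// ler_norm.
  have := normr_ge0 u; clear -u2 v1 v0 ub; nra.
have a0 := normr_ge0 a; have b0 := normr_ge0 b.
have Ks0 : 0 < K * s by rewrite mulr_gt0.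
have mul_le (x y x' y' : R) : `|x| <= x' -> `|y| <= y' -> x * y <= x' * y'.
  by move=> xx yy; rewrite (le_trans (ler_norm _))// normrM ler_pM.
have t1 : (p - a) * u <= (s + `|a|) * (6 * (K * s)).
  by apply: mul_le => //; rewrite (le_trans (ler_normB _ _))// lerD2r.
have t2 : q * v <= s * 1 by exact: mul_le.
have t3 : b * (1 - v) <= `|b| * (6 * (K * s)).
  apply: mul_le => //; rewrite ger0_norm ?(le_trans vu)// subr_ge0.
  by rewrite (le_trans _ vb)// ler_norm.
have t4 : - a * p <= `|a| * s by apply: mul_le; rewrite ?normrN.
have t5 : - b * q <= `|b| * s by apply: mul_le; rewrite ?normrN.
have t6 : p * p <= s * s by exact: mul_le.
have t7 : q * q <= s * s by exact: mul_le.
have t8 : K * ((a - p) ^+ 2 + (b - q) ^+ 2) <=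
    K * (a ^+ 2 + b ^+ 2 + 2 * (`|a| * s) + 2 * (`|b| * s) + 2 * (s * s)).
  by rewrite ler_pM2l//; clear -t4 t5 t6 t7; lra.
have t9 : K * s * s <= K * s by rewrite ger_pMr.
clear - h t1 t2 t3 t8 t9 a0 b0; lra.
Qed.

Variables (P : R -> R -> Prop) (K rho : R).
Hypotheses (K0 : 0 < K) (rho0 : 0 < rho) (PC : proximal_curve P K rho).

(** The vector is orthogonal to a short chord from [y]. In the frame of the chord, [chord_normal]
    applied to [P] and to its mirror image bounds the height of [P] from above and from below. *)
Lemma approximate_normal y1 y2 (e : R) : P y1 y2 -> 0 < e -> e < 1 ->
  exists u v, u ^+ 2 + v ^+ 2 = 1 /\ forall a b, P a b ->
    `|(a - y1) * u + (b - y2) * v| <=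
    K * dsq y1 y2 a b + e * (1 + 16 * K * (1 + `|a - y1| + `|b - y2|)).
Proof.
move=> Py e0 e1.
(* The chord must be shorter than [e] to control the error, and short against [1 / K] and [rho] for
   [chord_normal]. *)
pose s0 := Num.min e (Num.min (1 / (100 * K)) rho).
have s00 : 0 < s0 by rewrite !lt_min e0 rho0 andbT/= divr_gt0 ?mulr_gt0.
have [_ _ Paccu _] := PC.
have [|x1 [x2 [Px /andP[yx0 yxs]]]] := Paccu _ _ (Num.min 1 s0 ^+ 2) Py.
  by rewrite exprn_gt0// lt_min ltr01.
pose s := Num.sqrt (dsq y1 y2 x1 x2).
have ss : s ^+ 2 = dsq y1 y2 x1 x2 by rewrite sqr_sqrtr// ltW.
have sp : 0 < s by rewrite sqrtr_gt0.
have : s < Num.min 1 s0.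
  by rewrite -(@ltr_pXn2r _ 2) ?nnegrE ?ss ?ltW// lt_min ltr01.
rewrite !lt_min => /and4P[s1 se sK srho].
pose u := (x1 - y1) / s; pose v := (x2 - y2) / s.
have us : x1 - y1 = s * u by rewrite mulrC divfK ?gt_eqF.
have vs : x2 - y2 = s * v by rewrite mulrC divfK ?gt_eqF.
have uv : u ^+ 2 + v ^+ 2 = 1.
  apply: (mulfI (lt0r_neq0 (exprn_gt0 2 sp))); rewrite mulr1 {2}ss /dsq us vs; ring.
clearbody u v.
exists (- v), u; split; first by rewrite sqrrN addrC.
have kk : (1 : R) ^+ 2 = 1 by rewrite expr1n.
have kN : (-1 : R) ^+ 2 = 1 by rewrite sqrrN expr1n.
(* With axis [(1, 0)] and sign [-1] the frame is the reflection of [(a, b)] to [(a, - b)]. *)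
have ee : (1 : R) ^+ 2 + 0 ^+ 2 = 1 by rewrite expr1n expr0n addr0.
have PF := proximal_curve_frame uv kk y1 y2 PC.
have PN := proximal_curve_frame ee kN 0 0 PF.
set Q := frame _ _ _ _ _ _ in PF PN; set Q' := frame _ _ _ _ _ _ in PN.
have Q0 : Q 0 0 by rewrite /Q /frame !(mul0r,mulr0,subr0,addr0).
have Qs : Q s 0 by rewrite /Q /frame !(mul0r,mulr0,subr0,addr0) -us -vs !(addrC _ (_ - _)) !subrK.
have Q'E a b : Q' a b = Q a (- b) by rewrite /Q' /frame; congr Q; ring.
have srho' : s ^+ 2 < rho.
  by rewrite expr2 (lt_trans _ srho)// gtr_pMl.
have sK' : K * s <= 1 / 100.
  move: sK; rewrite ltr_pdivlMr ?mulr_gt0// => sK; clear -sK; lra.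
have [p [q [n1 [n2 [sQ nn [pb qb] nb n20]]]]] := chord_normal K0 PF Q0 Qs sp srho' sK'.
have [||p' [q' [n1' [n2' [sQ' nn' [pb' qb'] nb' n20']]]]] := chord_normal K0 PN _ _ sp srho' sK'.
- by rewrite Q'E oppr0.
- by rewrite Q'E oppr0.
have s01 : 0 < s <= 1 by rewrite sp ltW.
move=> x z; have [a [b [-> ->]]] := frame_point uv kk y1 y2 x z => Qab.
have := near_vertical_bound K0 s01 sQ nn pb qb nb n20 Qab.
have := @near_vertical_bound _ _ _ _ _ _ _ a (- b) K0 s01 sQ' nn' pb' qb' nb' n20'.
rewrite Q'E opprK sqrrN normrN => /(_ Qab) bm bp.
have -> : dsq y1 y2 (y1 + (a * u - 1 * b * v)) (y2 + (a * v + 1 * b * u)) = a ^+ 2 + b ^+ 2.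
  transitivity ((a ^+ 2 + b ^+ 2) * (u ^+ 2 + v ^+ 2)); first by rewrite /dsq; ring.
  by rewrite uv mulr1.
have yK (y w : R) : y + w - y = w by ring.
rewrite !yK !mul1r.
have bE : (a * u - b * v) * - v + (a * v + b * u) * u = b.
  by transitivity (b * (u ^+ 2 + v ^+ 2)); [ring|rewrite uv mulr1].
have aE : (a * u - b * v) * u + (a * v + b * u) * v = a.
  by transitivity (a * (u ^+ 2 + v ^+ 2)); [ring|rewrite uv mulr1].
rewrite bE; move: (a * u - b * v) (a * v + b * u) aE bE => X Y aE bE.
have [u1 v1] := unit_bound uv; rewrite -!ler_norml in u1 v1.
have le_norm1 (c d : R) : `|d| <= 1 -> `|c * d| <= `|c| by move=> d1; rewrite normrM ler_piMr.
have aXY : `|a| <= `|X| + `|Y|.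
  by rewrite -aE (le_trans (ler_normD _ _))// lerD// le_norm1.
have bXY : `|b| <= `|X| + `|Y|.
  by rewrite -[in `|b|]bE (le_trans (ler_normD _ _))// lerD// le_norm1 ?normrN.
have bound : s * (1 + 8 * K * (1 + `|a| + `|b|)) <= e * (1 + 16 * K * (1 + `|X| + `|Y|)).
  have c0 : 0 <= 1 + 8 * K * (1 + `|a| + `|b|).
    by rewrite addr_ge0// mulr_ge0 ?mulr_ge0 ?addr_ge0// ltW.
  rewrite ler_pM// ?(ltW sp) ?(ltW se)// lerD2l.
  have -> : 16 * K * (1 + `|X| + `|Y|) = 8 * K * (2 + 2 * `|X| + 2 * `|Y|) by ring.
  by rewrite ler_pM2l ?mulr_gt0//; clear -aXY bXY; lra.
by rewrite ler_norml; clear -bm bp bound; apply/andP; split; lra.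
Qed.

(** A cluster point of the approximate normals works: both the error term and the distance to the
    limit vector are at most [eta] times a constant depending on the tested point only. *)
Lemma exists_normal y1 y2 : P y1 y2 ->
  exists u v, u ^+ 2 + v ^+ 2 = 1 /\ forall a b, P a b ->
    `|(a - y1) * u + (b - y2) * v| <= K * dsq y1 y2 a b.
Proof.
move=> Py.
(* The parameter is the inverse of [i.+2], hence less than 1 from [i = 0] on. *)
have /choice[f fP] : forall i : nat, exists n : R * R, n.1 ^+ 2 + n.2 ^+ 2 = 1 /\
    forall a b, P a b -> `|(a - y1) * n.1 + (b - y2) * n.2| <=
      K * dsq y1 y2 a b + i.+2%:R^-1 * (1 + 16 * K * (1 + `|a - y1| + `|b - y2|)).
  move=> i; have [||u [v [uv h]]] := @approximate_normal y1 y2 i.+2%:R^-1 Py.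
  - by rewrite invr_gt0.
  - by rewrite invf_lt1// ltr1n.
  by exists (u, v).
have [c cP] := cluster_pair (fun i => unit_bound (fP i).1).
have cP' eta : 0 < eta -> exists i, [/\ i.+2%:R^-1 <= eta,
    `|c.1 - (f i).1| <= eta & `|c.2 - (f i).2| <= eta].
  move=> eta0; have [i [Ni c1 c2]] := cP eta (Num.truncn eta^-1) eta0.
  exists i; split; [|exact: ltW|exact: ltW].
  rewrite invf_ple// ?posrE//; apply/ltW/(lt_le_trans (truncnS_gt _)).
  by rewrite ler_nat ltnW// !ltnS.
exists c.1, c.2; split.
  suff : `|c.1 ^+ 2 + c.2 ^+ 2 - 1| <= 0 by rewrite normr_le0 subr_eq0 => /eqP.
  apply: (@le_of_small _ _ 6) => // eta /andP[eta0 eta1]; rewrite add0r.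
  have [i [_ c1 c2]] := cP' _ eta0; have [fi _] := fP i.
  have [f1 f2] := unit_bound fi; rewrite !ler_norml in c1 c2 *.
  have [c1b c2b] : - 2 <= c.1 <= 2 /\ - 2 <= c.2 <= 2 by clear -c1 c2 f1 f2 eta1; split; lra.
  have p1 : - (eta * 3) <= (c.1 - (f i).1) * (c.1 + (f i).1) <= eta * 3.
    by apply: mul_bound => //; clear -c1b f1; lra.
  have p2 : - (eta * 3) <= (c.2 - (f i).2) * (c.2 + (f i).2) <= eta * 3.
    by apply: mul_bound => //; clear -c2b f2; lra.
  by clear -p1 p2 fi; lra.
move=> a b Pab; apply: (@le_of_small _ _
  (1 + 16 * K * (1 + `|a - y1| + `|b - y2|) + `|a - y1| + `|b - y2|)).
  by rewrite !addr_ge0// mulr_ge0 ?addr_ge0// mulr_ge0// ltW.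
move=> eta /andP[eta0 _]; have [i [ie c1 c2]] := cP' _ eta0.
have [_ /(_ _ _ Pab) h] := fP i.
have -> : (a - y1) * c.1 + (b - y2) * c.2 = (a - y1) * (f i).1 + (b - y2) * (f i).2 +
  ((a - y1) * (c.1 - (f i).1) + (b - y2) * (c.2 - (f i).2)) by ring.
set C := 1 + _ in h *.
have -> : K * dsq y1 y2 a b + eta * (C + `|a - y1| + `|b - y2|) =
  K * dsq y1 y2 a b + eta * C + (`|a - y1| * eta + `|b - y2| * eta) by ring.
rewrite (le_trans (ler_normD _ _))// lerD//.
  rewrite (le_trans h)// lerD2l ler_wpM2r// addr_ge0// mulr_ge0 ?addr_ge0//.
  by rewrite mulr_ge0// ltW.
rewrite (le_trans (ler_normD _ _))// !normrM.
by rewrite lerD// ler_wpM2l.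
Qed.
End Normals.

(** * Local graphs *)

Section Slopes.
Variable R : realType.

(** The point [(s, t)], at distance [w] from the origin, is nearly on the horizontal axis, so its
    chord to any [(a, b)] close to the origin is nearly horizontal. A normal at [(a, b)] is almost
    orthogonal to this chord. *)
Lemma slope_bound (K s t a b u v w : R) : 0 < K -> 0 < w -> K * w <= 1 / 100 ->
  s ^+ 2 + t ^+ 2 = w ^+ 2 -> `|t| <= K * w ^+ 2 ->
  `|a| <= w / 100 -> `|b| <= w / 100 -> u ^+ 2 + v ^+ 2 = 1 ->
  `|(s - a) * u + (t - b) * v| <= K * dsq a b s t ->
  `|u| <= 6 / 100 /\ 99 / 100 <= `|v|.
Proof.
move=> K0 w0 Kw stw tK aw bw uv h.
have tw : `|t| <= w / 100.
  by rewrite (le_trans tK)// expr2 mulrA; move: (K * w) Kw => k Kw; clear -w0 Kw; nra.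
have sw : 98 / 100 * w <= `|s|.
  have t2 : t ^+ 2 <= (w / 100) ^+ 2 by apply: sqr_le_of_bound; rewrite -ler_norml.
  rewrite -(@ler_pXn2r _ 2) ?nnegrE// ?real_normK ?num_real//; last by clear -w0; lra.
  by have := sqr_ge0 w; clear -t2 stw; lra.
have sw' : `|s| <= w.
  rewrite -(@ler_pXn2r _ 2) ?nnegrE// ?real_normK ?num_real//; last exact: ltW.
  by have := sqr_ge0 t; clear -stw; lra.
have X1 : 97 / 100 * w <= `|s - a|.
  by have := lerB_dist s a; clear -sw aw; lra.
have X2 : `|s - a| <= 101 / 100 * w by have := ler_normB s a; clear -sw' aw; lra.
have Y1 : `|t - b| <= 2 / 100 * w by have := ler_normB t b; clear -tw bw; lra.
have D : K * dsq a b s t <= 3 / 100 * w.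
  have : dsq a b s t <= 2 * w ^+ 2.
    rewrite ler_norml in X2; rewrite ler_norml in Y1; rewrite /dsq.
    have := sqr_le_of_bound X2; have := sqr_le_of_bound Y1; have := sqr_ge0 w; clear; lra.
  rewrite -(ler_pM2l K0) => /le_trans; apply.
  have -> : K * (2 * w ^+ 2) = 2 * (K * w) * w by ring.
  by move: (K * w) Kw => k Kw; clear -w0 Kw; nra.
have [u1 v1] := unit_bound uv; rewrite -!ler_norml in u1 v1.
have vY : `|(t - b) * v| <= 2 / 100 * w.
  by rewrite normrM (le_trans _ Y1)// ler_piMr.
have uX : `|s - a| * `|u| <= 5 / 100 * w.
  rewrite -normrM -(addrK ((t - b) * v) ((s - a) * u)).
  by rewrite (le_trans (ler_normB _ _))//; clear -h D vY; lra.
have ub : `|u| <= 6 / 100.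
  rewrite leNgt; apply/negP => u6.
  have : 97 / 100 * w * (6 / 100) < `|s - a| * `|u|.
    rewrite (@le_lt_trans _ _ (`|s - a| * (6 / 100)))//; first by rewrite ler_wpM2r//; lra.
    by rewrite ltr_pM2l// (lt_le_trans _ X1)// mulr_gt0//; lra.
  by clear -uX w0; lra.
split => //; have u2 : u ^+ 2 <= (6 / 100) ^+ 2.
  by apply: sqr_le_of_bound; rewrite -ler_norml.
by rewrite -(@ler_pXn2r _ 2) ?nnegrE// ?real_normK ?num_real//; clear -uv u2; lra.
Qed.

(** For small [X] and [Y] the quadratic right-hand side is absorbed by the linear terms, which gives
    the cone. Dividing by [v] then leaves a remainder quadratic in [X] alone, for the slope
    [- (u / v)]. *)
Lemma cone_bound (K u v X Y : R) : 0 < K -> `|u| <= 6 / 100 -> 99 / 100 <= `|v| ->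
  K * `|X| <= 1 / 100 -> K * `|Y| <= 1 / 100 ->
  `|X * u + Y * v| <= K * (X ^+ 2 + Y ^+ 2) ->
  `|Y| <= `|X| / 10 /\ `|Y - - (u / v) * X| <= 2 * K * X ^+ 2.
Proof.
move=> K0 ub vb KX KY h.
have v0 : 0 < `|v| by clear -vb; lra.
have X0 := normr_ge0 X; have Y0 := normr_ge0 Y.
rewrite -(real_normK (num_real X)) -(real_normK (num_real Y)) in h *.
have hs : K * (`|X| ^+ 2 + `|Y| ^+ 2) <= 1 / 100 * (`|X| + `|Y|).
  have -> : K * (`|X| ^+ 2 + `|Y| ^+ 2) = (K * `|X|) * `|X| + (K * `|Y|) * `|Y| by ring.
  by rewrite mulrDr lerD// ler_wpM2r.
have Xu : `|X * u| <= `|X| * (6 / 100) by rewrite normrM ler_wpM2l.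
have Yv : `|Y| * (99 / 100) <= `|Y * v| by rewrite normrM ler_wpM2l.
have YX : `|Y| <= `|X| / 10.
  have : `|Y * v| <= `|X * u + Y * v| + `|X * u|.
    by rewrite -{1}(addKr (X * u) (Y * v)) addrC (le_trans (ler_normB _ _)).
  by clear -Xu Yv hs h X0; lra.
split => //.
have -> : Y - - (u / v) * X = (X * u + Y * v) / v.
  by field; rewrite -normr_gt0.
rewrite normrM normfV ler_pdivrMr// (le_trans h)//.
have Y2 : `|Y| ^+ 2 <= `|X| ^+ 2 / 100.
  have /sqr_le_of_bound : - (`|X| / 10) <= `|Y| <= `|X| / 10 by clear -YX X0 Y0; lra.
  by clear; lra.
have : K * `|X| ^+ 2 * (99 / 100) <= K * `|X| ^+ 2 * `|v|.
  by rewrite ler_wpM2l// mulr_ge0 ?sqr_ge0// ltW.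
have : K * (`|X| ^+ 2 + `|Y| ^+ 2) <= K * (`|X| ^+ 2 * (101 / 100)).
  by rewrite ler_pM2l//; clear -Y2; lra.
have : 0 <= K * `|X| ^+ 2 by rewrite mulr_ge0 ?sqr_ge0// ltW.
by clear; lra.
Qed.

Definition box (P : R -> R -> Prop) r a b := [/\ P a b, `|a| <= r & `|b| <= r].

(** A point of [P] at a small distance [w] from the origin exists by accumulation and serves as the
    far point of [slope_bound]; the box has half-side [w / 100]. The bound on [5 * r ^+ 2] lets
    [midpoint_near] apply to pairs of points of the box. *)
Lemma local_slopes (P : R -> R -> Prop) (K rho : R) : 0 < K -> 0 < rho ->
  proximal_curve P K rho -> P 0 0 ->
  (forall a b, P a b -> `|b| <= K * (a ^+ 2 + b ^+ 2)) ->
  exists r, [/\ 0 < r, r <= 1, 5 * r ^+ 2 < rho, K * r <= 1 / 100 &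
  forall a b, box P r a b -> exists m, forall a' b', box P r a' b' ->
    `|b' - b| <= `|a' - a| / 10 /\ `|b' - b - m * (a' - a)| <= 2 * K * (a' - a) ^+ 2].
Proof.
move=> K0 rho0 PC P0 PK.
pose w0 := Num.min 1 (Num.min (1 / (100 * K)) rho).
have w00 : 0 < w0 by rewrite !lt_min ltr01 rho0 andbT/= divr_gt0 ?mulr_gt0.
have [_ _ Paccu _] := PC.
have [|s [t [Pst]]] := Paccu _ _ (w0 ^+ 2) P0; first by rewrite exprn_gt0.
rewrite /dsq !subr0 => /andP[D0 Dw].
pose w := Num.sqrt (s ^+ 2 + t ^+ 2).
have ww : s ^+ 2 + t ^+ 2 = w ^+ 2 by rewrite sqr_sqrtr// ltW.
have wp : 0 < w by rewrite sqrtr_gt0.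
have : w < w0 by rewrite -(@ltr_pXn2r _ 2) ?nnegrE ?ltW// -ww.
rewrite !lt_min => /and3P[w1 wK wrho].
have wrho' : w ^+ 2 < rho by rewrite expr2 (lt_trans _ wrho)// gtr_pMl.
have wK' : K * w <= 1 / 100.
  move: wK; rewrite ltr_pdivlMr ?mulr_gt0// => wK; clear -wK; lra.
have tK := PK _ _ Pst; rewrite ww in tK.
exists (w / 100); split.
- by rewrite divr_gt0.
- by clear -w1; lra.
- by have := sqr_ge0 w; clear -wrho'; lra.
- have : 0 < K * w by rewrite mulr_gt0.
  by clear -wK'; lra.
move=> a b [Pab aw bw].
have [u [v [uv uvP]]] := exists_normal K0 rho0 PC Pab.
have [ub vb] := slope_bound K0 wp wK' ww tK aw bw uv (uvP _ _ Pst).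
exists (- (u / v)) => a' b' [Pab' aw' bw'].
apply: cone_bound ub vb _ _ (uvP _ _ Pab') => //.
  have : K * `|a' - a| <= K * w.
    by rewrite ler_pM2l// (le_trans (ler_normB _ _))//; clear -aw aw' wp; lra.
  by clear -wK'; lra.
have : K * `|b' - b| <= K * w.
  by rewrite ler_pM2l// (le_trans (ler_normB _ _))//; clear -bw bw' wp; lra.
by clear -wK'; lra.
Qed.

(** The point of [P] near the midpoint is off by at most [(a' - a) / 40], so its abscissa lies in
    the middle half of the bracket. Replacing one end by it keeps [c] bracketed and removes at least
    a quarter of the length. *)
Lemma box_bisect (P : R -> R -> Prop) (K rho r c a b a' b' : R) : 0 < K ->
  proximal_curve P K rho -> 0 < r -> 5 * r ^+ 2 < rho -> K * r <= 1 / 100 ->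
  box P r a b -> box P r a' b' -> a <= c <= a' ->
  `|b| <= `|a| / 10 -> `|b'| <= `|a'| / 10 -> `|b' - b| <= `|a' - a| / 10 ->
  exists p q p' q', [/\ box P r p q, box P r p' q', p <= c <= p' &
    p' - p <= 3 / 4 * (a' - a)].
Proof.
move=> K0 PC r0 rrho Kr [Pab ar br] [Pab' ar' br'] /andP[ac ca] b10 b10' bb.
have aa : 0 <= a' - a by rewrite subr_ge0 (le_trans ac).
rewrite (ger0_norm aa) in bb.
have ar2 : a' - a <= 2 * r.
  by have := ler_norm a'; have := ler_norm (- a); rewrite normrN; clear -ar ar'; lra.
have D : dsq a b a' b' <= 101 / 100 * ((a' - a) * (a' - a)).
  rewrite /dsq; rewrite ler_norml in bb; have := sqr_le_of_bound bb; clear; lra.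
have D2 : (a' - a) * (a' - a) <= (a' - a) * (2 * r) by rewrite ler_wpM2l.
have D3 : (a' - a) * (2 * r) <= (2 * r) * (2 * r) by rewrite ler_pM2r// mulr_gt0.
have KD : K * dsq a b a' b' <= (a' - a) / 40.
  have : K * dsq a b a' b' <= K * (101 / 100 * ((a' - a) * (2 * r))).
    by rewrite ler_pM2l//; clear -D D2; lra.
  have : (a' - a) * (K * r) <= (a' - a) * (1 / 100) by rewrite ler_wpM2l.
  by clear -aa; lra.
have KD0 : 0 <= K * dsq a b a' b' by rewrite mulr_ge0 ?(ltW K0)// addr_ge0 ?sqr_ge0.
have [|p [q [Ppq]]] := midpoint_near K0 PC Pab Pab'.
  by have := sqr_ge0 r; clear -D D2 D3 rrho; lra.
move=> /sqr_bound -/(_ KD0)[ph qh].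
have pb : a + (a' - a) / 4 <= p <= a' - (a' - a) / 4 by clear -ph KD aa; lra.
have boxp : box P r p q.
  rewrite !ler_norml in ar ar' b10 b10' *.
  have a1 : `|a| <= r by rewrite ler_norml.
  have a1' : `|a'| <= r by rewrite ler_norml.
  by split; rewrite ?ler_norml//; [clear -pb ar ar' aa|clear -qh KD b10 b10' a1 a1' ar2]; lra.
have [pc|cp] := leP p c.
  by exists p, q, a', b'; split => //; rewrite ?pc//; clear -pb; lra.
by exists a, b, p, q; split => //; rewrite ?ac ?(ltW cp)//; clear -pb; lra.
Qed.

(** Iterated bisection gives points of the box whose abscissae tend to [c]; a cluster point has
    abscissa [c] and belongs to the closed set [P]. *)
Lemma box_interval (P : R -> R -> Prop) (K rho r c a b a' b' : R) : 0 < K ->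
  proximal_curve P K rho -> 0 < r <= 1 -> 5 * r ^+ 2 < rho -> K * r <= 1 / 100 ->
  (forall a b a' b', box P r a b -> box P r a' b' -> `|b' - b| <= `|a' - a| / 10) ->
  (forall a b, box P r a b -> `|b| <= `|a| / 10) ->
  box P r a b -> box P r a' b' -> a <= c <= a' -> exists d, box P r c d.
Proof.
move=> K0 PC /andP[r0 r1] rrho Kr bb b10 boxa boxa' aca'.
have bis i : exists p q p' q', [/\ box P r p q, box P r p' q', p <= c <= p' &
    p' - p <= (3 / 4) ^+ i * (a' - a)].
  elim: i => [|i [p [q [p' [q' [boxp boxp' pcp' ppi]]]]]].
    by exists a, b, a', b'; rewrite expr0 mul1r.
  have [|||u [v [u' [v' [boxu boxu' ucu' uu]]]]] := box_bisect K0 PC r0 rrho Kr boxp boxp' pcp'.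
  - exact: b10 boxp.
  - exact: b10 boxp'.
  - exact: bb boxp boxp'.
  exists u, v, u', v'; split => //; rewrite (le_trans uu)// exprS -[leRHS]mulrA ler_pM2l//.
have /choice[f fP] : forall i, exists x : R * R,
    box P r x.1 x.2 /\ `|x.1 - c| <= (3 / 4) ^+ i * (a' - a).
  move=> i; have [p [q [p' [q' [boxp _ /andP[pc cp'] ppi]]]]] := bis i.
  exists (p, q); split => //=; rewrite ler0_norm ?subr_le0//; lra.
have [|x xP] := @cluster_pair _ f.
  by move=> i; have [[_ fi1 fi2] _] := fP i; rewrite -!ler_norml !(le_trans _ r1).
have aa : 0 <= a' - a by have /andP[ac ca] := aca'; rewrite subr_ge0 (le_trans ac).
have close (e : R) : 0 < e -> exists i, [/\ `|x.1 - (f i).1| < e,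
    `|x.2 - (f i).2| < e & `|(f i).1 - c| < e].
  move=> e0.
  have : (3 / 4) ^+ i * (a' - a) @[i --> \oo] --> (0 : R).
    rewrite -(mul0r (a' - a)); apply: cvgMr_tmp; apply: cvg_expr.
    by rewrite ger0_norm; lra.
  move=> /cvgr0_norm_lt/(_ e e0)[N _ NP].
  have [i [Ni x1 x2]] := xP e N e0; exists i; split => //.
  have [_ /le_lt_trans] := fP i; apply; rewrite (le_lt_trans (ler_norm _))//.
  exact: NP.
have xc : x.1 = c.
  apply/eqP; rewrite -subr_eq0 -normr_le0; apply/ler_addgt0Pr => e e0; rewrite add0r.
  have [|i [x1 _ fc]] := close (e / 2); first by rewrite divr_gt0.
  by rewrite -(subrKA (f i).1) (le_trans (ler_normD _ _))//; lra.
exists x.2; rewrite -xc; split.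
- apply: contrapT => Px; have [Pclosed _ _ _] := PC.
  have [e e0 eP] := Pclosed _ _ Px.
  have [|i [x1 x2 _]] := close (Num.min 1 (e / 2)); first by rewrite lt_min ltr01 divr_gt0.
  have [[Pi _ _] _] := fP i; apply: (eP _ _ _ Pi).
  have small (z y : R) : `|z - y| < Num.min 1 (e / 2) -> (y - z) ^+ 2 < e / 2.
    rewrite lt_min => /andP[z1 ze]; rewrite -real_normK ?num_real// distrC.
    by rewrite (le_lt_trans _ ze)// expr2 ler_piMl// ltW.
  by have := small _ _ x1; have := small _ _ x2; rewrite /dsq; lra.
- apply/ler_addgt0Pr => e e0; have [i [x1 _ _]] := close e e0.
  have [[_ fi _] _] := fP i.
  by rewrite -(subrK (f i).1 x.1) addrC (le_trans (ler_normD _ _))// lerD// ltW.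
- apply/ler_addgt0Pr => e e0; have [i [_ x1 _]] := close e e0.
  have [[_ _ fi] _] := fP i.
  by rewrite -(subrK (f i).2 x.2) addrC (le_trans (ler_normD _ _))// lerD// ltW.
Qed.

End Slopes.

(** * The graph function and its extension beyond an endpoint *)

Section LocalGraph.
Variable R : realType.

(** This encodes class C^{1,1} with derivative [M]: using the estimate at both [a] and [b] also
    makes [M] Lipschitz. *)
Definition taylor_bound (F M : R -> R) (e L : R) := forall a b,
  `|a| < e -> `|b| < e -> `|F b - F a - M a * (b - a)| <= L * (b - a) ^+ 2.

Definition curve_or_ray (P : R -> R -> Prop) (F : R -> R) (e h : R) :=
  (forall a b, `|a| < e -> `|b| < h -> (P a b <-> b = F a)) \/
  (forall a b, `|a| < e -> `|b| < h -> (P a b <-> 0 <= a /\ b = F a)).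

Definition slopes (P : R -> R -> Prop) r L :=
  forall a b, box P r a b -> exists m, forall a' b', box P r a' b' ->
    `|b' - b| <= `|a' - a| / 10 /\ `|b' - b - m * (a' - a)| <= L * (a' - a) ^+ 2.

(** The extension follows the tangent at 0, with the same constant. For [b < 0 <= a], the estimates
    between 0 and [a] give [|M 0 - M a| <= 2 L a], and [L a^2 + 2 L a |b|] is at most
    [L (b - a)^2]. *)
Lemma taylor_extend (F M : R -> R) (e L : R) : 0 <= L -> F 0 = 0 ->
  (forall a b, 0 <= a < e -> 0 <= b < e ->
    `|F b - F a - M a * (b - a)| <= L * (b - a) ^+ 2) ->
  taylor_bound (fun a => if a < 0 then M 0 * a else F a)
    (fun a => if a < 0 then M 0 else M a) e L.
Proof.
move=> L0 F0 FM a b ae be.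
have [a0|a0] := ltP a 0; have [b0|b0] := ltP b 0.
- have -> : M 0 * b - M 0 * a - M 0 * (b - a) = 0 by ring.
  by rewrite normr0 mulr_ge0 ?sqr_ge0.
- have e0 : 0 < e by rewrite (le_lt_trans _ ae).
  have := FM 0 b; rewrite F0 !subr0 lexx e0 b0 (ger0_norm b0) in be *.
  move=> /(_ isT be).
  have -> : F b - M 0 * a - M 0 * (b - a) = F b - M 0 * b by ring.
  move=> /le_trans; apply; rewrite ler_wpM2l// ler_pXn2r ?nnegrE//; clear -a0 b0; lra.
- have e0 : 0 < e by rewrite (le_lt_trans _ ae).
  rewrite (ger0_norm a0) in ae.
  have h1 := FM a 0; rewrite F0 a0 ae lexx e0 in h1; have {}h1 := h1 isT isT.
  have h2 := FM 0 a; rewrite F0 a0 ae lexx e0 in h2; have {}h2 := h2 isT isT.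
  have h3 : `|a * (M 0 - M a)| <= 2 * L * a ^+ 2.
    have -> : a * (M 0 - M a) = - (F a - 0 - M 0 * (a - 0)) - (0 - F a - M a * (0 - a)) by ring.
    by rewrite (le_trans (ler_normB _ _))// normrN; clear -h1 h2; lra.
  have h4 : `|M 0 - M a| * a <= 2 * L * a * a.
    by rewrite normrM (ger0_norm a0) in h3; clear -h3; lra.
  have -> : M 0 * b - F a - M a * (b - a) = (0 - F a - M a * (0 - a)) + (M 0 - M a) * b by ring.
  rewrite (le_trans (ler_normD _ _))// normrM (ltr0_norm b0).
  have h5 : `|M 0 - M a| <= 2 * L * a.
    have [a00|] := eqVneq a 0; first by rewrite a00 subrr normr0 mulr0.
    by move=> an; rewrite -(ler_pM2r (_ : 0 < a))// lt0r an.
  have : `|M 0 - M a| * - b <= 2 * L * a * - b by rewrite ler_wpM2r// oppr_ge0 ltW.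
  have : 0 <= L * b ^+ 2 by rewrite mulr_ge0 ?sqr_ge0.
  by clear -h1; lra.
- by apply: FM; [rewrite a0 (ger0_norm a0) in ae *|rewrite b0 (ger0_norm b0) in be *].
Qed.

(** The abscissae met in the box form an interval containing 0 and [a0]. If a negative one occurs,
    [P] is a graph on both sides of 0; otherwise it is a ray, and [taylor_extend] supplies a
    function on a full neighbourhood. *)
Lemma graph_right (P : R -> R -> Prop) (K rho r L a0 b0 : R) : 0 < K -> 0 <= L ->
  proximal_curve P K rho -> 0 < r <= 1 -> 5 * r ^+ 2 < rho -> K * r <= 1 / 100 ->
  P 0 0 -> slopes P r L -> 0 < a0 -> box P r a0 b0 ->
  exists e F M, [/\ 0 < e, taylor_bound F M e L & curve_or_ray P F e r].
Proof.
move=> K0 L0 PC r01 rrho Kr P0 sl a00 boxa.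
have /andP[r0 r1] := r01.
have box0 : box P r 0 0 by split; rewrite ?normr0 ?ltW.
have bb a b a' b' : box P r a b -> box P r a' b' -> `|b' - b| <= `|a' - a| / 10.
  by move=> ba ba'; have [m /(_ _ _ ba')[]] := sl _ _ ba.
have b10 a b : box P r a b -> `|b| <= `|a| / 10.
  by move=> ba; have := bb _ _ _ _ box0 ba; rewrite !subr0.
have uniq a b b' : box P r a b -> box P r a b' -> b' = b.
  move=> ba ba'; have := bb _ _ _ _ ba ba'; rewrite subrr normr0 mul0r normr_le0 subr_eq0.
  by move=> /eqP.
(* The pair holds the ordinate and the slope at abscissa [a], and [(0, 0)] where the box has no
   point over [a]. *)
have /choice[g gP] : forall a, exists y : R * R, forall b, box P r a b ->
    b = y.1 /\ forall a' b', box P r a' b' -> `|b' - y.1 - y.2 * (a' - a)| <= L * (a' - a) ^+ 2.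
  move=> a; have [[b ba]|nb] := pselect (exists b, box P r a b); last first.
    by exists (0, 0) => b ba; case: nb; exists b.
  have [m mP] := sl _ _ ba; exists (b, m) => b' ba'.
  split; first exact: (uniq _ _ _ ba ba').
  by move=> a'' b'' /mP[].
pose f a := (g a).1; pose m a := (g a).2.
have fP a b : box P r a b -> b = f a by move=> /gP[].
have mP a b a' b' : box P r a b -> box P r a' b' ->
    `|f a' - f a - m a * (a' - a)| <= L * (a' - a) ^+ 2.
  by move=> /gP[_ gb] /[dup] /gb; move=> + /fP <-.
have f0 : f 0 = 0 by rewrite -(fP _ _ box0).
have inter := box_interval K0 PC r01 rrho Kr bb b10.
have ar : a0 <= r by case: boxa => _ + _; rewrite gtr0_norm.
have right a : 0 <= a <= a0 -> exists b, box P r a b by move=> aa; exact: inter box0 boxa aa.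
have [[a1 [b1 [a10 boxa1]]]|left] := pselect (exists a1 b1, a1 < 0 /\ box P r a1 b1).
  have all a : a1 <= a <= a0 -> exists b, box P r a b by move=> aa; exact: inter boxa1 boxa aa.
  have a1r : - a1 <= r by case: boxa1 => _ + _; rewrite ltr0_norm.
  exists (Num.min a0 (- a1)), f, m; split.
  - by rewrite lt_min a00 oppr_gt0.
  - move=> a b; rewrite !lt_min !ltr_norml => /andP[aa aa1] /andP[ba ba1].
    have [|y ya] := all a; first by clear -aa aa1; lra.
    have [|z zb] := all b; first by clear -ba ba1; lra.
    exact: mP ya zb.
  - left => a b; rewrite lt_min => /andP[aa aa1] br.
    have boxab : P a b -> box P r a b by move=> Pab; split => //; rewrite ltW// (lt_le_trans aa).
    split => [/boxab/fP//|->].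
    have [|y ya] := all a; first by rewrite !ltr_norml in aa aa1; clear -aa aa1; lra.
    by rewrite -(fP _ _ ya); case: ya.
exists a0, (fun a => if a < 0 then m 0 * a else f a), (fun a => if a < 0 then m 0 else m a).
split => //.
  apply: taylor_extend => // a b /andP[aa aa0] /andP[ba ba0].
  have [|y ya] := right a; first by rewrite aa ltW.
  have [|z zb] := right b; first by rewrite ba ltW.
  exact: mP ya zb.
right => a b aa br.
have boxab : P a b -> box P r a b by move=> Pab; split => //; rewrite ltW// (lt_le_trans aa).
split => [/boxab ba|[a_ge0]].
  have a_ge0 : 0 <= a by rewrite leNgt; apply/negP => an; apply: left; exists a, b.
  by rewrite ltNge a_ge0; split => //; exact: fP.
rewrite ltNge a_ge0 /= => ->; have [|y ya] := right a.
  by rewrite a_ge0 ltW// -(ger0_norm a_ge0).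
by rewrite -(fP _ _ ya); case: ya.
Qed.

(** The sign [c] turns a nearby point of [P] to the right of the origin, as [graph_right] requires;
    its abscissa is nonzero by the cone estimate. *)
Lemma local_graph (P : R -> R -> Prop) (K rho : R) : 0 < K -> 0 < rho ->
  proximal_curve P K rho -> P 0 0 ->
  (forall a b, P a b -> `|b| <= K * (a ^+ 2 + b ^+ 2)) ->
  exists c e h L F M, [/\ c ^+ 2 = 1, [/\ 0 < e, 0 < h & 0 <= L],
    taylor_bound F M e L & curve_or_ray (fun a b => P (c * a) b) F e h].
Proof.
move=> K0 rho0 PC P0 PK.
have [r [r0 r1 rrho Kr sl]] := local_slopes K0 rho0 PC P0 PK.
have L0 : 0 <= 2 * K by rewrite mulr_ge0// ltW.
have [_ _ Paccu _] := PC.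
have [|a [b [Pab]]] := Paccu _ _ (r ^+ 2) P0; first by rewrite exprn_gt0.
rewrite /dsq !subr0 => /andP[D0 Dr].
have boxa : box P r a b.
  by have [] := sqr_bound (ltW r0) (ltW Dr); split => //; rewrite ler_norml.
have ba : `|b| <= `|a| / 10.
  have box0 : box P r 0 0 by split; rewrite ?normr0 ?ltW.
  by have [m /(_ _ _ boxa)[]] := sl _ _ box0; rewrite !subr0.
have r01 : 0 < r <= 1 by rewrite r0.
have [a_lt0|a_gt0|a0] := ltgtP a 0; last first.
- move: ba D0; rewrite a0 normr0 mul0r normr_le0 => /eqP ->.
  by rewrite expr0n addr0 ltxx.
- have [e [F [M [e0 FM PF]]]] := graph_right K0 L0 PC r01 rrho Kr P0 sl a_gt0 boxa.
  exists 1, e, r, (2 * K), F, M; split => //; first by rewrite expr1n.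
  by case: PF => PF; [left|right] => x y xe yr; rewrite mul1r; exact: PF.
have cc : (- 1 : R) ^+ 2 = 1 by rewrite sqrrN expr1n.
have ee : (- 1 : R) ^+ 2 + 0 ^+ 2 = 1 by rewrite cc expr0n addr0.
(* Axis [(-1, 0)] with sign [-1] gives the reflection of [(a, b)] to [(- a, b)]. *)
have := proximal_curve_frame ee cc 0 0 PC; set Q := frame _ _ _ _ _ _ => QC.
have QE x y : Q x y = P (- x) y by rewrite /Q /frame; congr P; ring.
have boxQ x y : box Q r x y -> box P r (- x) y.
  by move=> []; rewrite QE => *; split => //; rewrite normrN.
have slQ : slopes Q r (2 * K).
  move=> x y /boxQ/sl[m mP]; exists (- m) => x' y' /boxQ/mP.
  have -> : - x' - - x = - (x' - x) by ring.
  by rewrite normrN sqrrN mulrN mulNr.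
have Q0 : Q 0 0 by rewrite QE oppr0.
have an : 0 < - a by rewrite oppr_gt0.
have boxQa : box Q r (- a) b by case: boxa => *; split; rewrite ?QE ?opprK ?normrN.
have [e [F [M [e0 FM PF]]]] := graph_right K0 L0 QC r01 rrho Kr Q0 slQ an boxQa.
exists (- 1), e, r, (2 * K), F, M; split => //.
by case: PF => PF; [left|right] => x y xe yr; rewrite mulN1r -QE; exact: PF.
Qed.

End LocalGraph.

(** * Charts *)

Section AffineGraph.
Variable R : realType.

Definition vec (a b : R) : 'rV[R]_2 := \row_(i < 2) (if i == 0 then a else b).

Lemma vec0 a b : vec a b 0 0 = a. Proof. by rewrite mxE. Qed.
Lemma vec1 a b : vec a b 0 1 = b. Proof. by rewrite mxE. Qed.

Lemma ord2P (i : 'I_2) : i = 0 \/ i = 1.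
Proof. by case: i => [[|[|//]] ?]; [left|right]; apply: val_inj. Qed.

Lemma vecE (x : 'rV[R]_2) : x = vec (x 0 0) (x 0 1).
Proof. by apply/rowP => i; case: (ord2P i) => ->; rewrite ?vec0 ?vec1. Qed.

Lemma dot2 (x y : 'rV[R]_2) : dot x y = x 0 0 * y 0 0 + x 0 1 * y 0 1.
Proof. by rewrite /dot !big_ord_recl big_ord0 addr0 (_ : lift _ _ = 1)//; apply: val_inj. Qed.

Lemma cvg_dnbhs0_of_linear (q : R -> R) (D C e : R) : 0 < e -> 0 <= C ->
  (forall t, t != 0 -> `|t| < e -> `|D - q t| <= C * `|t|) ->
  q t @[t --> 0^'] --> D.
Proof.
move=> e0 C0 qD; apply/cvgrPdist_lt => eps eps0; near=> t.
apply: le_lt_trans (qD t _ _) _.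
- by near: t; exact: nbhs_dnbhs_neq.
- by near: t; exact: dnbhs0_lt.
have : `|t| < eps / (C + 1).
  by near: t; apply: dnbhs0_lt; rewrite divr_gt0// ltr_wpDl.
rewrite ltr_pdivlMr ?ltr_wpDl// => /le_lt_trans; apply.
by rewrite mulrDr mulr1 mulrC lerDl.
Unshelve. all: by end_near. Qed.

Section Graph.
Variables (F M : R -> R) (e L : R).
Hypotheses (e0 : 0 < e) (L0 : 0 <= L) (FM : taylor_bound F M e L).

(** In the sum of the estimates for [(a, b)] and [(b, a)] the values of [F] cancel. *)
Lemma taylor_slope_lipschitz a b : `|a| < e -> `|b| < e ->
  `|M a - M b| <= 2 * L * `|a - b|.
Proof.
move=> ae be; have [->|ab] := eqVneq a b; first by rewrite !subrr normr0 mulr0.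
have ab0 : 0 < `|a - b| by rewrite normr_gt0 subr_eq0.
rewrite -(ler_pM2r ab0) -normrM.
have -> : (M a - M b) * (a - b) = (F b - F a - M a * (b - a)) + (F a - F b - M b * (a - b)) by ring.
rewrite (le_trans (ler_normD _ _))// (le_trans (lerD (FM ae be) (FM be ae)))//.
have -> : (b - a) ^+ 2 = (a - b) ^+ 2 by ring.
by rewrite -(real_normK (num_real (a - b))); lra.
Qed.

Lemma taylor_slope_bounded a : `|a| < e -> `|M a| <= `|M 0| + 2 * L * e.
Proof.
move=> ae; have := @taylor_slope_lipschitz a 0 ae; rewrite normr0 subr0 => /(_ e0) h.
rewrite -(subrK (M 0) (M a)) addrC (le_trans (ler_normD _ _))// lerD2l (le_trans h)//.
by rewrite ler_wpM2l ?mulr_ge0// ltW.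
Qed.

Lemma taylor_lipschitz a b : `|a| < e -> `|b| < e ->
  `|F a - F b| <= (`|M 0| + 2 * L * e + 2 * L * e) * `|a - b|.
Proof.
move=> ae be; rewrite -(subrK (M b * (a - b)) (F a - F b)).
rewrite (le_trans (ler_normD _ _))// addrC mulrDl lerD//.
  by rewrite normrM ler_wpM2r// taylor_slope_bounded.
rewrite (le_trans (FM be ae))// -real_normK ?num_real// expr2 mulrA ler_wpM2r//.
rewrite -mulrA mulrCA ler_wpM2l// (le_trans (ler_normB _ _))//; lra.
Qed.

Lemma taylor_derivable a : `|a| < e -> derivable F a 1.
Proof.
move=> ae; apply/cvg_ex; exists (M a).
apply: (@cvg_dnbhs0_of_linear _ _ L (e - `|a|)) => //; first by rewrite subr_gt0.
move=> t t0 te; rewrite /GRing.scale/= mulr1.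
have tae : `|t + a| < e by rewrite (le_lt_trans (ler_normD _ _))// -ltrBrDr.
rewrite -(ler_pM2r (_ : 0 < `|t|)) ?normr_gt0// -normrM -mulrA -expr2 real_normK ?num_real//.
have := FM ae tae; rewrite addrK; congr (_ <= _).
rewrite -normrN; congr (`| _ |); field; exact: t0.
Qed.

Variables (a b c k a' b' c' : R) (U : set 'rV[R]_2).
Let l (x : 'rV[R]_2) := a' * x 0 0 + b' * x 0 1 + c'.
(** Every coordinate of the charts and of their inverses has this form, so regularity is proved
    once. *)
Let g (x : 'rV[R]_2) := a * x 0 0 + b * x 0 1 + c + k * F (l x).

Let l_lipschitz x y : `|l x - l y| <= (`|a'| + `|b'|) * enorm (x - y).
Proof.
have -> : l x - l y = a' * (x - y) 0 0 + b' * (x - y) 0 1 by rewrite /l !mxE; ring.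
rewrite (le_trans (ler_normD _ _))// mulrDl !normrM.
by rewrite lerD// ler_wpM2l// normr_coord_enorm.
Qed.

Lemma derive_affine_graph x v : `|l x| < e ->
  'D_v g x = a * v 0 0 + b * v 0 1 + k * (M (l x) * (a' * v 0 0 + b' * v 0 1)).
Proof.
move=> lx; apply: cvg_lim; first exact: norm_hausdorff.
set w := a' * v 0 0 + b' * v 0 1.
(* For [|t| < s] the argument of [F] stays in the interval where the Taylor bound holds; adding 1
   avoids a zero denominator. *)
pose s := (e - `|l x|) / (`|w| + 1).
have w1 : 0 < `|w| + 1 by rewrite ltr_wpDl.
have s0 : 0 < s by rewrite divr_gt0// subr_gt0.
apply: (@cvg_dnbhs0_of_linear _ _ (`|k| * L * w ^+ 2) s) => //.
  by apply: mulr_ge0; [exact: mulr_ge0|exact: sqr_ge0].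
move=> t t0 ts; rewrite /GRing.scale/=.
have lt : l (t *: v + x) = l x + t * w by rewrite /l /w !mxE; ring.
have ltx : `|l x + t * w| < e.
  rewrite (le_lt_trans (ler_normD _ _))// -ltrBrDl normrM.
  rewrite (@le_lt_trans _ _ (`|t| * (`|w| + 1)))//; first by rewrite ler_wpM2l// lerDl.
  by rewrite -ltr_pdivlMr.
rewrite -(ler_pM2r (_ : 0 < `|t|)) ?normr_gt0// -normrM.
have -> : (a * v 0 0 + b * v 0 1 + k * (M (l x) * w) - t^-1 * (g (t *: v + x) - g x)) * t =
    - (k * (F (l x + t * w) - F (l x) - M (l x) * (l x + t * w - l x))).
  by rewrite /g lt !mxE; field.
rewrite normrN normrM -!mulrA ler_wpM2l//.
rewrite (le_trans (FM lx ltx))// ler_wpM2l//.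
have -> : (l x + t * w - l x) ^+ 2 = w ^+ 2 * t ^+ 2 by ring.
by rewrite [leRHS]mulrA -!expr2 real_normK ?num_real.
Qed.

Lemma differentiable_affine_graph x : `|l x| < e -> differentiable g x.
Proof.
move=> lx.
have dc i : differentiable (fun x : 'rV[R]_2 => x 0 i) x by exact: differentiable_coord.
have dl (p q r : R) : differentiable (fun x : 'rV[R]_2 => p * x 0 0 + q * x 0 1 + r) x.
  apply: differentiableD; last exact: differentiable_cst.
  by apply: differentiableD; apply: differentiableZ.
apply: differentiableD; first exact: dl.
apply: differentiableZ; apply: (@differentiable_comp _ _ _ _ l F); first exact: dl.
by apply/derivable1_diffP; exact: taylor_derivable.
Qed.

Lemma class_C_holder_affine_graph : (forall x, U x -> `|l x| < e) ->
  class_C_holder 1 1 U g.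
Proof.
move=> Ul; split; last split.
- set C := `|M 0| + 2 * L * e + 2 * L * e.
  exists (`|a| + `|b| + `|k| * (C * (`|a'| + `|b'|))) => x y Ux Uy.
  rewrite powRr1 ?enorm_ge0//.
  have -> : g x - g y = (a * (x - y) 0 0 + b * (x - y) 0 1) + k * (F (l x) - F (l y)).
    by rewrite /g !mxE; ring.
  have C0 : 0 <= C by rewrite !addr_ge0// !mulr_ge0// ltW.
  rewrite (le_trans (ler_normD _ _))// mulrDl lerD//.
    rewrite (le_trans (ler_normD _ _))// mulrDl !normrM.
    by rewrite lerD// ler_wpM2l// normr_coord_enorm.
  rewrite normrM -mulrA ler_wpM2l// (le_trans (taylor_lipschitz (Ul _ Ux) (Ul _ Uy)))//.
  by rewrite -/C -mulrA ler_wpM2l.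
- by move=> x Ux; exact/differentiable_affine_graph/Ul.
move=> i; split => //; pose v : 'rV[R]_2 := delta_mx 0 i.
pose w := a' * v 0 0 + b' * v 0 1.
exists (`|k * w| * (2 * L * (`|a'| + `|b'|))) => x y Ux Uy.
rewrite powRr1 ?enorm_ge0// !derive_affine_graph; [|exact: Ul|exact: Ul].
rewrite -/w opprD addrACA subrr add0r.
have -> : k * (M (l x) * w) - k * (M (l y) * w) = k * w * (M (l x) - M (l y)) by ring.
rewrite normrM -[leRHS]mulrA ler_wpM2l//.
rewrite (le_trans (taylor_slope_lipschitz (Ul _ Ux) (Ul _ Uy)))//.
by rewrite -[leRHS]mulrA ler_wpM2l// mulr_ge0.
Qed.

End Graph.
End AffineGraph.

Section Chart.
Variable R : realType.

Lemma dot_vecB (a b s t : R) : dot (vec a b - vec s t) (vec a b - vec s t) = dsq s t a b.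
Proof. by rewrite dot2 !mxE /= /dsq !expr2. Qed.

Lemma enorm_lt_sqr n (x : 'rV[R]_n) (e : R) : 0 < e -> (enorm x < e) = (dot x x < e ^+ 2).
Proof.
by move=> e0; rewrite -sqr_enorm ltr_pXn2r ?nnegrE ?enorm_ge0// ltW.
Qed.

Lemma open_enorm_ball n (x : 'rV[R]_n) (e : R) : open [set z | enorm (z - x) < e].
Proof.
have -> : [set z | enorm (z - x) < e] = (fun z => enorm (z - x)) @^-1` [set r | r < e] by [].
by apply: open_comp; [move=> z _; exact: continuous_enormB|exact: open_lt].
Qed.

(** [proximal_normal] gives [K = 1 / r], valid up to distance [r / 2]. Empty interior and
    connectedness supply the remaining density and accumulation properties. *)
Lemma proximal_curve_of_C1 (S : set 'rV[R]_2) : connected S ->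
  interior S = set0 -> proximally_C 1 S -> (~ exists p, S = [set p]) ->
  exists K rho, [/\ 0 < K, 0 < rho & proximal_curve (fun a b => S (vec a b)) K rho].
Proof.
move=> cnS intS [S0 cS [r r0 [_ [dS _]]]] nS.
exists r^-1, ((r / 2) ^+ 2); split; first by rewrite invr_gt0.
  by rewrite exprn_gt0// divr_gt0.
split.
- move=> a b Sab.
  have /nbhs_ballP[e /= e0 eS] : nbhs (vec a b) (~` S).
    by apply: open_nbhs_nbhs; split => //; exact: closed_openC.
  exists (e ^+ 2); first by rewrite exprn_gt0.
  move=> s t st; apply: eS; rewrite mx_norm_ball /ball_/= distrC.
  by rewrite (le_lt_trans (normr_enorm _))// enorm_lt_sqr// dot_vecB.
- move=> a b e e0; apply: contrapT => nP.
  suff : interior S (vec a b) by rewrite intS.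
  apply: (@filterS _ _ _ [set z | enorm (z - vec a b) < Num.sqrt e]); last first.
    apply: open_nbhs_nbhs; split; first exact: open_enorm_ball.
    by rewrite /= subrr enorm0 sqrtr_gt0.
  move=> z /=; rewrite enorm_lt_sqr ?sqrtr_gt0// sqr_sqrtr ?ltW// (vecE z) dot_vecB => ze.
  by apply: contrapT => nz; apply: nP; exists (z 0 0), (z 0 1).
(* An isolated point would be open and closed in the connected set [S], which would then be a
   singleton. *)
- move=> a b e Sab e0; apply: contrapT => nP; apply: nS; exists (vec a b).
  apply/esym/cnS; first by exists (vec a b).
    exists [set z | enorm (z - vec a b) < Num.sqrt e]; first exact: open_enorm_ball.
    apply/seteqP; split => [_ ->|z [Sz]] /=.
      by rewrite subrr enorm0 sqrtr_gt0.
    rewrite enorm_lt_sqr ?sqrtr_gt0// sqr_sqrtr ?ltW// => ze.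
    apply: contrapT => zn; apply: nP; exists (z 0 0), (z 0 1).
    rewrite -vecE -dot_vecB -vecE; split => //; rewrite ze andbT lt0r dot_ge0 andbT.
    by apply/eqP => /dot_eq0/eqP; rewrite subr_eq0 => /eqP.
  exists [set vec a b]; last by apply/seteqP; split => [_ ->|_ [_ ->]].
  by apply: accessible_closed_set1; apply: hausdorff_accessible; exact: norm_hausdorff.
move=> a b s t Sab Sst st.
have dst : dist_to S (vec a b) < r / 2.
  rewrite (le_lt_trans (dist_to_le S0 _ Sst))// enorm_lt_sqr ?divr_gt0//.
  by rewrite dot_vecB dsqC.
have dd x : 0 < dist_to S x < r -> differentiable (dist_to S) x by exact: dS.
have [p [u [Sp uu abp pP]]] := proximal_normal S0 cS dd Sab dst.
exists (p 0 0), (p 0 1), (u 0 0), (u 0 1), (dist_to S (vec a b)); split.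
- split; [by rewrite -vecE|by rewrite !expr2 -dot2|exact: dist_to_gt0].
- by have := congr1 (fun x : 'rV_2 => x 0 0) abp; rewrite vec0 !mxE.
- by have := congr1 (fun x : 'rV_2 => x 0 1) abp; rewrite vec1 !mxE.
- move=> s' t' Sst'; rewrite dsqC -dot_vecB -sqr_enorm ler_pXn2r ?nnegrE ?enorm_ge0//.
    exact: dist_to_le.
  exact: dist_to_ge0.
move=> s' t' /pP; rewrite mulrC ler_pdivlMl// mulrC.
by rewrite {2 3}(vecE p) dot_vecB dot2 !mxE.
Qed.

(** With [A] and [B] the coordinates in the frame, the shear sending [(A, B)] to [(A, B - F A)]
    flattens the graph, and adding [F] back inverts it. Orthonormality of both rows and columns
    makes [T] a two-sided inverse of [(A, B)]. *)
Lemma chart_of_graph (S : set 'rV[R]_2) (y1 y2 p q u v e h L : R) (F M : R -> R) :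
  [/\ p ^+ 2 + q ^+ 2 = 1, u ^+ 2 + v ^+ 2 = 1 & p * u + q * v = 0] ->
  [/\ p ^+ 2 + u ^+ 2 = 1, q ^+ 2 + v ^+ 2 = 1 & p * q + u * v = 0] ->
  0 < e -> 0 < h -> 0 <= L -> taylor_bound F M e L -> S (vec y1 y2) ->
  curve_or_ray (fun a b => S (vec (y1 + (p * a + u * b)) (y2 + (q * a + v * b)))) F e h ->
  exists (U V : set 'rV[R]_2) (phi psi : 'rV[R]_2 -> 'rV[R]_2),
    [/\ open U /\ U (vec y1 y2), open V, diffeo_C_holder 1 1 U V phi psi &
        phi @` (S `&` U) = V `&` @flat R 1 2 \/
        phi @` (S `&` U) = V `&` @half_flat R 1 2].
Proof.
move=> [pq uv puqv] [pu qv pquv] e0 h0 L0 FM Sy SF.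
pose A (x : 'rV[R]_2) := p * x 0 0 + q * x 0 1 + - (p * y1 + q * y2).
pose B (x : 'rV[R]_2) := u * x 0 0 + v * x 0 1 + - (u * y1 + v * y2).
pose T a b : 'rV[R]_2 := vec (y1 + (p * a + u * b)) (y2 + (q * a + v * b)).
have AT a b : A (T a b) = a.
  rewrite /A vec0 vec1; transitivity ((p ^+ 2 + q ^+ 2) * a + (p * u + q * v) * b); first by ring.
  by rewrite pq puqv; ring.
have BT a b : B (T a b) = b.
  rewrite /B vec0 vec1; transitivity ((p * u + q * v) * a + (u ^+ 2 + v ^+ 2) * b); first by ring.
  by rewrite uv puqv; ring.
have TAB x : T (A x) (B x) = x.
  rewrite [RHS]vecE /T; congr vec; rewrite /A /B.
    transitivity (y1 + ((p ^+ 2 + u ^+ 2) * (x 0 0 - y1) + (p * q + u * v) * (x 0 1 - y2))).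
      by ring.
    by rewrite pu pquv; ring.
  transitivity (y2 + ((p * q + u * v) * (x 0 0 - y1) + (q ^+ 2 + v ^+ 2) * (x 0 1 - y2))).
      by ring.
  by rewrite qv pquv; ring.
pose phi x := vec (A x) (B x - F (A x)).
pose psi (z : 'rV[R]_2) := T (z 0 0) (z 0 1 + F (z 0 0)).
pose U := [set x | `|A x| < e /\ `|B x| < h].
pose V := [set z : 'rV[R]_2 | `|z 0 0| < e /\ `|z 0 1 + F (z 0 0)| < h].
have phiK x : psi (phi x) = x by rewrite /psi /phi vec0 vec1 subrK TAB.
have psiK z : phi (psi z) = z by rewrite /psi /phi AT BT addrK -vecE.
have UV x : U x -> V (phi x) by rewrite /V /phi /= vec0 vec1 subrK.
have VU z : V z -> U (psi z) by rewrite /U /psi /= AT BT.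
exists U, V, phi, psi.
have C := class_C_holder_affine_graph e0 L0 FM.
have near_lt (a b c k a' b' c' m : R) (x : 'rV[R]_2) (g : 'rV[R]_2 -> R) :
    (forall z, g z = a * z 0 0 + b * z 0 1 + c + k * F (a' * z 0 0 + b' * z 0 1 + c')) ->
    `|a' * x 0 0 + b' * x 0 1 + c'| < e -> `|g x| < m -> \forall z \near x, `|g z| < m.
  move=> /funext -> xe.
  have /differentiable_continuous := differentiable_affine_graph L0 FM a b c k xe.
  by move=> /cvgr_norm_lt; apply.
split.
- split; last first.
    have <- : T 0 0 = vec y1 y2 by rewrite /T !(mulr0, addr0).
    by split; rewrite ?AT ?BT normr0.
  (* The case [k = 0] of [near_lt], where the argument of [F] is constantly 0. *)
  have near_affine (a b c m : R) (x : 'rV[R]_2) : `|a * x 0 0 + b * x 0 1 + c| < m ->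
      nbhs x [set z : 'rV[R]_2 | `|a * z 0 0 + b * z 0 1 + c| < m].
    apply: (near_lt a b c 0 0 0 0) => [z|]; first by rewrite mul0r addr0.
    by rewrite !mul0r !addr0 normr0.
  by rewrite openE => x [Ax Bx]; apply: filterI; exact: near_affine.
- rewrite openE => z [z0 zF]; apply: filterI.
    apply: (near_lt 1 0 0 0 1 0 0) => [w||//]; first by ring.
    by rewrite mul1r mul0r !addr0.
  apply: (near_lt 0 1 0 1 1 0 0) => [w||//]; first by rewrite !(mul1r, mul0r, addr0, add0r).
  by rewrite mul1r mul0r !addr0.
- split.
  + by move=> x Ux; split; [exact: UV|exact: phiK].
  + by move=> z Vz; split; [exact: VU|exact: psiK].
  + move=> i; case: (ord2P i) => ->.
      have -> : (fun x => phi x 0 0) =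
          (fun x => p * x 0 0 + q * x 0 1 + - (p * y1 + q * y2) + 0 * F (A x)).
        by apply/funext => x; rewrite vec0 mul0r addr0.
      by apply: C => x [].
    have -> : (fun x => phi x 0 1) =
          (fun x => u * x 0 0 + v * x 0 1 + - (u * y1 + v * y2) + -1 * F (A x)).
      by apply/funext => x; rewrite vec1 mulN1r.
    by apply: C => x [].
  + have lz (z : 'rV[R]_2) : z 0 0 = 1 * z 0 0 + 0 * z 0 1 + 0 by ring.
    move=> i; case: (ord2P i) => ->.
      have -> : (fun z => psi z 0 0) =
          (fun z => p * z 0 0 + u * z 0 1 + y1 + u * F (1 * z 0 0 + 0 * z 0 1 + 0)).
        by apply/funext => z; rewrite vec0 -lz; ring.
      by apply: C => z []; rewrite -lz.
    have -> : (fun z => psi z 0 1) =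
          (fun z => q * z 0 0 + v * z 0 1 + y2 + v * F (1 * z 0 0 + 0 * z 0 1 + 0)).
      by apply/funext => z; rewrite vec1 -lz; ring.
    by apply: C => z []; rewrite -lz.
have flatE (z : 'rV[R]_2) : flat 1 z <-> z 0 1 = 0.
  by split => [/(_ 1 isT)//|z1 i]; case: (ord2P i) => ->.
have half_flatE (z : 'rV[R]_2) : half_flat 1 z <-> 0 <= z 0 0 /\ z 0 1 = 0.
  split => [[/flatE ? /(_ 0 erefl)]//|[z0 /flatE z1]].
  by split => // i; case: (ord2P i) => ->.
case: SF => SF; [left|right]; apply/seteqP; split.
- move=> _ [x [Sx Ux] <-]; split; first exact: UV.
  apply/flatE; rewrite vec1; have [Ax Bx] := Ux.
  have := SF _ _ Ax Bx; rewrite -/(T (A x) (B x)) TAB => -[/(_ Sx) -> _].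
  by rewrite subrr.
- move=> z [Vz /flatE z1]; exists (psi z) => //; split; last exact: VU.
  have [z0 zF] := Vz; rewrite z1 add0r in zF.
  by rewrite /psi z1 add0r; apply/SF.
- move=> _ [x [Sx Ux] <-]; split; first exact: UV.
  apply/half_flatE; rewrite vec0 vec1; have [Ax Bx] := Ux.
  have := SF _ _ Ax Bx; rewrite -/(T (A x) (B x)) TAB => -[/(_ Sx)[A0 ->] _].
  by rewrite subrr.
- move=> z [Vz /half_flatE[z00 z1]]; exists (psi z) => //; split; last exact: VU.
  have [z0 zF] := Vz; rewrite z1 add0r in zF.
  by rewrite /psi z1 add0r; apply/SF.
Qed.

End Chart.

Unset Implicit Arguments.

Theorem theorem2 (R : realType) (S : set 'rV[R]_2)
  (S_connected : connected S)
  (S_interior : interior S = set0)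
  (S_proximal : proximally_C 1 S) :
  (exists p : 'rV[R]_2, S = [set p]) \/ submanifold_C_holder 1 1 1 S.
Proof.
have [Sp|Sp] := pselect (exists p : 'rV[R]_2, S = [set p]); [by left|right].
have [K [rho [K0 rho0 PC]]] := proximal_curve_of_C1 S_connected S_interior S_proximal Sp.
move=> y Sy; pose y1 := y 0 0; pose y2 := y 0 1.
rewrite (vecE y) -/y1 -/y2 in Sy *.
have [u [v [uv uvP]]] := exists_normal K0 rho0 PC Sy.
(* The first axis is [(v, - u)], so that with sign 1 the second axis is the normal [(u, v)]. *)
have ee : v ^+ 2 + (- u) ^+ 2 = 1 by rewrite sqrrN addrC.
have kk : (1 : R) ^+ 2 = 1 by rewrite expr1n.
have := proximal_curve_frame ee kk y1 y2 PC; set Q := frame _ _ _ _ _ _ => QC.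
have QE a b : Q a b = S (vec (y1 + (v * a + u * b)) (y2 + (- u * a + v * b))).
  by rewrite /Q /frame; congr (S (vec _ _)); ring.
have Q0 : Q 0 0 by rewrite QE !mulr0 !addr0.
have Qb a b : Q a b -> `|b| <= K * (a ^+ 2 + b ^+ 2).
  rewrite QE => /uvP; congr (_ <= _).
    congr `| _ |; transitivity (b * (u ^+ 2 + v ^+ 2)); first by ring.
    by rewrite uv mulr1.
  congr (K * _); rewrite /dsq.
  transitivity ((a ^+ 2 + b ^+ 2) * (u ^+ 2 + v ^+ 2)); first by ring.
  by rewrite uv mulr1.
have [c [e [h [L [F [M [cc [e0 h0 L0] FM QF]]]]]]] := local_graph K0 rho0 QC Q0 Qb.
(* The sign [c] from [local_graph] is absorbed into the first axis. *)
apply: (chart_of_graph (p := c * v) (q := - (c * u)) (u := u) (v := v) _ _ e0 h0 L0 FM Sy).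
- split=> //; last by ring.
  by transitivity (c ^+ 2 * (u ^+ 2 + v ^+ 2)); [ring|rewrite cc uv mulr1].
- split.
  + by transitivity (c ^+ 2 * v ^+ 2 + u ^+ 2); [ring|rewrite cc mul1r addrC].
  + by transitivity (c ^+ 2 * u ^+ 2 + v ^+ 2); [ring|rewrite cc mul1r].
  + by transitivity ((1 - c ^+ 2) * (u * v)); [ring|rewrite cc subrr mul0r].
have QcE a b : S (vec (y1 + (c * v * a + u * b)) (y2 + (- (c * u) * a + v * b))) = Q (c * a) b.
  by rewrite QE; congr (S (vec _ _)); ring.
by case: QF => QF; [left|right] => a b ae bh; rewrite QcE; exact: QF.
Qed.
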